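(* Let $\mathbb{F}$ be a field of characteristic $2$ and let $L$ be a nilpotent symplectic alternating algebra over $\mathbb{F}$ of dimension $10$ that has an isotropic center of dimension $3$. Suppose also that $L$ has the further properties that $\dim L^3=6$, $L^3L^2=L^5$ and $L$ is of type $C$ where the minimal polynomial $m(y_2,y_3)$ is irreducible with a non-zero linear term. Then $L$ has a presentation of the form $$\mathcal{P}_{10}^{(3,9)}(\gamma,r,s):\quad (x_2y_4,y_5)=\gamma,\ (x_1y_3,y_4)=r,\ (x_1y_3,y_5)=s,\ (x_1y_2,y_4)=1,\ (y_1y_2,y_5)=1,\ (y_1y_3,y_4)=1,$$ where $\gamma,r,s\in\mathbb{F}$, $\gamma,r\neq 0$ and $t^2+rt+s$ is irreducible in $\mathbb{F}[t]$. Furthermore the presentations $\mathcal{P}_{10}^{(3,9)}(\tilde\gamma,\tilde r,\tilde s)$ and $\mathcal{P}_{10}^{(3,9)}(\gamma,r,s)$ (both with parameters satisfying these conditions) describe the same algebra if and only if $$\frac{\tilde\gamma}{\gamma}\in(\mathbb{F}^* )^3,\qquad \frac{\tilde r}{r}\in G(r,s)\qquad\text{and}\qquad \tilde s-\left(\frac{\tilde r}{r}\right)^2s\in H(\tilde r),$$ where $H(r)=\{x^2+rx:\ x\in\mathbb{F}\}$ and $G(r,s)=\{x^2+rxy+sy^2:\ (x,y)\in\mathbb{F}\times\mathbb{F}\setminus\{(0,0)\}\}$.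
   Context: A symplectic alternating algebra (SAA) over a field $\mathbb{F}$ is a finite-dimensional vector space $L$ over $\mathbb{F}$ with a non-degenerate alternating bilinear form $(\ ,\ )$ and a bilinear product $\cdot$ satisfying $u\cdot u=0$ for all $u$ and $(u\cdot v,w)=(v\cdot w,u)$ for all $u,v,w\in L$. No associativity or Jacobi identity is assumed. The map $(u,v,w)\mapsto(uv,w)$ is then an alternating trilinear form. A standard basis (in dimension $10$) is a basis $x_1,y_1,\ldots,x_5,y_5$ with $(x_i,x_j)=(y_i,y_j)=0$ and $(x_i,y_j)=\delta_{ij}$ for all $i,j$. Presentations: $L$ has a presentation if there is a standard basis for which the listed values of triples $(uv,w)$ hold and $(uv,w)=0$ for all triples of basis elements that are not a reordering of a listed one. Two presentations describe the same algebra if the corresponding $10$-dimensional SAA's are isomorphic (by a linear bijection preserving product and form). $\mathbb{F}^*=\mathbb{F}\setminus\{0\}$, $(\mathbb{F}^* )^3=\{a^3:a\in\mathbb{F}^*\}$. For subspaces $U,V$, $UV$ is the span of all products $uv$. $L^1=L$, $L^{m+1}=L^mL$; $Z_0(L)=\{0\}$, $Z_{m+1}(L)=\{x: xL\leq Z_m(L)\}$, $Z(L)=Z_1(L)$. $L$ is nilpotent if $L^{m+1}=\{0\}$ for some $m\ge 0$. $Z(L)$ is isotropic if $(u,v)=0$ for all $u,v\in Z(L)$. Type and minimal polynomial: let $L$ be nilpotent of dimension $10$ with isotropic center of dimension $3$, $\dim L^3=6$ and $L^3L^2=L^5$. Then one can choose a standard basis with $L^5=\mathbb{F}x_5+\mathbb{F}x_4$,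 $Z(L)=L^5+\mathbb{F}x_3$, $L^4=Z_2(L)=Z(L)+\mathbb{F}x_2$, $L^3=Z_3(L)=L^4+\mathbb{F}x_1+\mathbb{F}y_1$, $L^2=L^3+\mathbb{F}y_2$, $Z_4(L)=L^2+\mathbb{F}y_3$. The linear maps $\phi,\psi:L^3/L^4\to L^5$, $\phi(u+L^4)=uy_2$, $\psi(u+L^4)=uy_3$ are well defined, $\phi$ is bijective, and the minimal polynomial $m(y_2,y_3)$ of $\tau=\psi\phi^{-1}:L^5\to L^5$ has degree $2$. $L$ is of type $C$ if this minimal polynomial is irreducible in $\mathbb{F}[t]$. In characteristic $2$, neither this property nor whether the coefficient of $t$ in $m(y_2,y_3)$ is zero depends on the choice of such a standard basis. *)

(* Defs.v *)
From HB Require Import structures.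
From mathcomp Require Import all_boot all_order all_algebra.

Set Implicit Arguments.
Unset Strict Implicit.
Unset Printing Implicit Defensive.

Import GRing.Theory.
Local Open Scope ring_scope.

Record saa (F : fieldType) := Saa {
  saa_carrier :> vectType F;
  sform : {biscalar saa_carrier};
  smul : {bilinear saa_carrier -> saa_carrier -> saa_carrier};
  sform_alt : forall u, sform u u = 0;
  sform_nondeg : forall u, (forall v, sform u v = 0) -> u = 0;
  smul_alt : forall u, smul u u = 0;
  saa_cyclic : forall u v w, sform (smul u v) w = sform (smul v w) u
}.

Section Series.

Variables (F : fieldType) (L : saa F).
Implicit Types (U V W : {vspace L}) (u v x : L).

(* As for prodv in falgebra.v, which requires an associative product, it is
   enough to multiply the elements of two bases: see smulvP. *)
Definition smulv U V : {vspace L} :=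
  <<[seq smul L u v | u <- vbasis U, v <- vbasis V]>>%VS.

Lemma smulvP U V W :
  reflect (forall u v, u \in U -> v \in V -> smul L u v \in W)
          (smulv U V <= W)%VS.
Proof.
apply: (iffP idP) => [sUVW u v /coord_vbasis -> /coord_vbasis -> | sUVW].
  rewrite linear_sumlz memv_suml // => i _.
  rewrite linear_sumr memv_suml // => j _.
  rewrite linearZl_LR linearZr_LR !memvZ //; apply: (subvP sUVW).
  rewrite memv_span //.
  by apply/allpairsP; exists ((vbasis U)`_i, (vbasis V)`_j); rewrite !memt_nth.
apply/span_subvP=> _ /allpairsP[[u v] /= [Uu Vv ->]].
by apply: sUVW; apply: vbasis_mem.
Qed.

(* lpow m is L^m for m >= 1; lpow 0 is a dummy value. *)
Fixpoint lpow (m : nat) : {vspace L} :=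
  if m is k.+1 then if k is 0 then fullv else smulv (lpow k) fullv else fullv.

Definition saa_nilpotent : Prop := exists m, lpow m.+1 = 0%VS.

(* ucs m.+1 = {x | x L <= ucs m}, obtained as the intersection, over a basis
   of L, of the preimages of ucs m by right multiplications: see memv_ucsS. *)
Fixpoint ucs (m : nat) : {vspace L} :=
  if m is k.+1 then
    (\bigcap_(i < \dim {:L})
       linfun ((smul L)^~ (vbasis {:L})`_i) @^-1: ucs k)%VS
  else 0%VS.

Lemma memv_ucsS m x :
  reflect (forall v, smul L x v \in ucs m) (x \in ucs m.+1).
Proof.
have memI (I : finType) (W : I -> {vspace L}) :
  reflect (forall i, x \in W i) (x \in (\bigcap_i W i)%VS).
  rewrite memvE; apply: (iffP subv_bigcapP) => H i.
    by rewrite memvE H.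
  by move=> _; rewrite -memvE.
apply: (iffP (memI _ _)) => [xZ v | xZ i]; last first.
  rewrite -memv_preim (lfunE (applyr (smul L) _)); exact: xZ.
rewrite (coord_vbasis (memvf v)) linear_sumr memv_suml // => i _.
rewrite linearZr_LR memvZ //; move: (xZ i).
by rewrite -memv_preim (lfunE (applyr (smul L) _)).
Qed.

Definition center : {vspace L} := ucs 1.

Definition isotropic U : Prop := {in U &, forall u v, sform L u v = 0}.

End Series.

Arguments lpow {F} L m.
Arguments ucs {F} L m.
Arguments saa_nilpotent {F} L.
Arguments center {F} L.

(* Labels of the basis vectors: inl i is x_(i+1) and inr i is y_(i+1). *)
Definition label : finType := ('I_5 + 'I_5)%type.

Definition x1 : label := inl (@Ordinal 5 0 isT).
Definition x2 : label := inl (@Ordinal 5 1 isT).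
Definition x3 : label := inl (@Ordinal 5 2 isT).
Definition x4 : label := inl (@Ordinal 5 3 isT).
Definition x5 : label := inl (@Ordinal 5 4 isT).
Definition y1 : label := inr (@Ordinal 5 0 isT).
Definition y2 : label := inr (@Ordinal 5 1 isT).
Definition y3 : label := inr (@Ordinal 5 2 isT).
Definition y4 : label := inr (@Ordinal 5 3 isT).
Definition y5 : label := inr (@Ordinal 5 4 isT).

Definition standard_basis (F : fieldType) (L : saa F) (e : label -> L) : Prop :=
  [/\ basis_of fullv (codom e),
      forall i j, sform L (e (inl i)) (e (inl j)) = 0,
      forall i j, sform L (e (inr i)) (e (inr j)) = 0
    & forall i j, sform L (e (inl i)) (e (inr j)) = (i == j)%:R].

(* (a, b, c, v) stands for the relation (ab, c) = v. *)
Definition presentation (F : fieldType) := seq (label * label * label * F).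

Definition has_presentation (F : fieldType) (L : saa F) (P : presentation F) :
    Prop :=
  exists e : label -> L,
  [/\ standard_basis e,
      forall a b c v, (a, b, c, v) \in P -> sform L (smul L (e a) (e b)) (e c) = v
    & forall a b c,
        (forall a' b' c' v, (a', b', c', v) \in P ->
           ~~ perm_eq [:: a; b; c] [:: a'; b'; c']) ->
        sform L (smul L (e a) (e b)) (e c) = 0].

Definition saa_isomorphic (F : fieldType) (A B : saa F) : Prop :=
  exists f : {linear A -> B},
  [/\ bijective f,
      forall u v, f (smul A u v) = smul B (f u) (f v)
    & forall u v, sform B (f u) (f v) = sform A u v].

(* A presentation prescribes the form, and hence the product, on a basis, so
   an algebra with a given presentation is unique up to isomorphism. *)
Definition same_algebra (F : fieldType) (P Q : presentation F) : Prop :=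
  exists A B : saa F,
  [/\ has_presentation A P, has_presentation B Q & saa_isomorphic A B].

Section TypeC.

Variables (F : fieldType) (L : saa F).

Definition adapted_basis (e : label -> L) : Prop :=
  standard_basis e
  /\ lpow L 5 = (<[e x5]> + <[e x4]>)%VS
  /\ center L = (lpow L 5 + <[e x3]>)%VS
  /\ lpow L 4 = ucs L 2 /\ ucs L 2 = (center L + <[e x2]>)%VS
  /\ lpow L 3 = ucs L 3 /\ ucs L 3 = (lpow L 4 + <[e x1]> + <[e y1]>)%VS
  /\ lpow L 2 = (lpow L 3 + <[e y2]>)%VS
  /\ ucs L 4 = (lpow L 2 + <[e y3]>)%VS.

(* The map u + L^4 |-> u y from L^3 / L^4 to L^5, the quotient being
   represented by the complement L^3 :\: L^4 of L^4 in L^3; the projection to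
   L^5 does nothing when L^3 y <= L^5. *)
Definition quo_action (y : L) :
    'Hom(subvs_of (lpow L 3 :\: lpow L 4), subvs_of (lpow L 5)) :=
  linfun (fun u => vsproj (lpow L 5) (smul L (vsval u) y)).

(* tau = psi phi^-1 with phi and psi the actions of y and y'; (_^-1)%VF is the
   inverse map when phi is bijective. *)
Definition tau (y y' : L) : 'End(subvs_of (lpow L 5)) :=
  (quo_action y' \o (quo_action y)^-1)%VF.

End TypeC.

Section MinimalPolynomial.

Variables (F : fieldType) (V : vectType F).

Definition lfun_eval (p : {poly F}) (f : 'End(V)) : 'End(V) :=
  \sum_(i < size p) p`_i *: iter i (comp_lfun f) \1%VF.

Definition is_minpoly (f : 'End(V)) (m : {poly F}) : Prop :=
  [/\ m \is monic, lfun_eval m f = 0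
    & forall q, lfun_eval q f = 0 -> m %| q].

End MinimalPolynomial.

Definition type_C_nonzero_linear_term (F : fieldType) (L : saa F) : Prop :=
  exists (e : label -> L) (m : {poly F}),
  [/\ adapted_basis e, is_minpoly (tau (e y2) (e y3)) m,
      irreducible_poly m & m`_1 != 0].

Section Family.

Variable F : fieldType.

Definition P10_3_9 (gamma r s : F) : presentation F :=
  [:: (x2, y4, y5, gamma); (x1, y3, y4, r); (x1, y3, y5, s);
      (x1, y2, y4, 1); (y1, y2, y5, 1); (y1, y3, y4, 1)].

Definition admissible (gamma r s : F) : Prop :=
  [/\ gamma != 0, r != 0 & irreducible_poly ('X^2 + r *: 'X + s%:P)].

Definition nonzero_cube (a : F) : Prop := exists2 b, b != 0 & a = b ^+ 3.

Definition in_H (r a : F) : Prop := exists x, a = x ^+ 2 + r * x.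

Definition in_G (r s a : F) : Prop :=
  exists x y, (x, y) != (0, 0) /\ a = x ^+ 2 + r * x * y + s * y ^+ 2.

End Family.

(* Main.v *)
Require Import Defs.
From HB Require Import structures.
From mathcomp Require Import all_boot all_order all_algebra.
From mathcomp Require Import ring.

(** A symplectic alternating algebra is the same thing as a symplectic space
    with an alternating trilinear form (uv, w), so both halves of the theorem
    are about moving such a form by symplectic changes of basis.  A standard
    basis turns the form into a sum of 3 x 3 determinants of coordinates, and a
    change of basis is justified by two polynomial identities, one for the
    symplectic form and one for the trilinear form (change_of_basis).

    Put W = <x1, y1>, N = <y2, y3>, V = <y4, y5>.  In an adapted basis the
    central series and the equation L^3 L^2 = L^5 kill all triples but
    (x2 y4, y5) = gamma, those in W x N x V, and six more, which a unipotent
    change of basis removes because gamma and the determinant of y2, seen as a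
    pairing W x V -> F, are not zero (adapted_presented, filtered_reduced).
    What remains is gamma and a tensor on W x N x V.

    The map tau compares the pairings W x V -> F given by y3 and by y2.  As its
    minimal polynomial is irreducible and tau is not a scalar, tau has no
    eigenvector; hence y1 y2 and y1 y3 are a basis of L^5, which can be taken
    as (x5, x4) once y3 is scaled so that (x1, y1) = 1 holds for the x1 with
    x1 y2 = y1 y3.  Then tau is a companion matrix: r and s are read off its
    minimal polynomial (minpoly_quadratic, typeC_admissible,
    reduced_normal_form).

    Two bases of the same algebra that realise two presentations of the family
    are related by a block triangular matrix, because the upper central series
    and the orthogonal of the center are intrinsic.  On W it is a matrix of
    determinant 1 with second row (p, q), on N it maps y2 to c y2 and y3 to
    a y3 + b y2.  The determinant of the pairing W x V -> F defined by a vector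
    of N is a quadratic form on N, and the determinant of the pairing
    N x V -> F defined by a vector of W is one on W.  Their transformation
    rules say that gamma is multiplied by c^-3, that r is multiplied by
    a / c, that s is multiplied by (a / c)^2 up to an element of H, and that
    c / a is a value of the norm form x^2 + r x y + s y^2
    (change_of_parameters).  As G is stable under
    inversion, these are the three invariants.  Conversely, given the
    invariants, c, a, b, p, q can be recovered and define a block diagonal
    change of basis in the algebra presented by gamma, r and s
    (P10_3_9_same).

    Signs are kept so that the polynomial identities hold over every field;
    characteristic 2 is used to discard the term 2 b in the rule for r and to
    read the forms with the signs of the statement. *)

Set Implicit Arguments.
Unset Strict Implicit.
Unset Printing Implicit Defensive.

Import GRing.Theory.
Local Open Scope ring_scope.

(** * Alternating trilinear forms in coordinates *)

Section Forms.

Variable F : fieldType.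
Implicit Types (al be ka : label -> F) (P : presentation F).

Definition omega al be : F :=
  al x1 * be y1 - al y1 * be x1 + (al x2 * be y2 - al y2 * be x2)
  + (al x3 * be y3 - al y3 * be x3) + (al x4 * be y4 - al y4 * be x4)
  + (al x5 * be y5 - al y5 * be x5).

Definition det3 al be ka (i j k : label) : F :=
  al i * (be j * ka k - be k * ka j) - al j * (be i * ka k - be k * ka i)
  + al k * (be i * ka j - be j * ka i).

(** The alternating form prescribed by a presentation: the sum of the terms
    t a* /\ b* /\ c* over its entries (a, b, c, t), where a* is the coordinate
    of label a. *)
Definition tri P al be ka : F :=
  \sum_(q <- P) q.2 * det3 al be ka q.1.1.1 q.1.1.2 q.1.2.

Definition std (a : label) : label -> F := fun b => (a == b)%:R.

(** Distinct entries of an irredundant presentation never prescribe the same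
    triple product, so its relations are consistent whatever their values:
    see tri_std_in. *)
Definition irredundant P : bool :=
  all (fun q => uniq [:: q.1.1.1; q.1.1.2; q.1.2]) P
  && pairwise (fun q q' => ~~ perm_eq [:: q.1.1.1; q.1.1.2; q.1.2]
                                      [:: q'.1.1.1; q'.1.1.2; q'.1.2]) P.

Lemma omega_ext al al' be be' :
  al =1 al' -> be =1 be' -> omega al be = omega al' be'.
Proof. by move=> E E'; rewrite /omega !E !E'. Qed.

Lemma tri_ext P al al' be be' ka ka' :
  al =1 al' -> be =1 be' -> ka =1 ka' -> tri P al be ka = tri P al' be' ka'.
Proof.
by move=> E E' E''; apply: eq_bigr => q _; rewrite /det3 !E !E' !E''.
Qed.

Lemma tri_cyclic P al be ka : tri P al be ka = tri P be ka al.
Proof. by apply: eq_bigr => q _; rewrite /det3; ring. Qed.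

Lemma tri_swap P al be ka : tri P be al ka = - tri P al be ka.
Proof. by rewrite /tri -sumrN; apply: eq_bigr => q _; rewrite /det3; ring. Qed.

Lemma tri_linear P c al al' be ka :
  tri P (fun i => c * al i + al' i) be ka = c * tri P al be ka + tri P al' be ka.
Proof.
rewrite /tri mulr_sumr -big_split /=.
by apply: eq_bigr => q _; rewrite /det3; ring.
Qed.

Lemma det3_std_out a b c i j k :
  ~~ perm_eq [:: a; b; c] [:: i; j; k] -> det3 (std a) (std b) (std c) i j k = 0.
Proof.
move=> nP; have ijkP : perm_eq [:: i; j; k] [:: i; j; k] by [].
have nil u v w : perm_eq [:: u; v; w] [:: i; j; k] ->
    std a u * (std b v * std c w) = 0.
  move=> uvwP; rewrite /std.
  case: eqP => [au|_]; last by rewrite mul0r.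
  case: eqP => [bv|_]; last by rewrite mul0r mulr0.
  case: eqP => [cw|_]; last by rewrite !mulr0.
  by move: nP; rewrite au bv cw uvwP.
have sw u v w : perm_eq [:: v; u; w] [:: i; j; k] =
                perm_eq [:: u; v; w] [:: i; j; k].
  exact: (perm_catCA [:: v] [:: u] [:: w]).
have rt u v w : perm_eq [:: v; w; u] [:: i; j; k] =
                perm_eq [:: u; v; w] [:: i; j; k].
  exact: (perm_catC [:: v; w] [:: u]).
have jikP : perm_eq [:: j; i; k] [:: i; j; k] by rewrite sw.
have jkiP : perm_eq [:: j; k; i] [:: i; j; k] by rewrite rt.
have kijP : perm_eq [:: k; i; j] [:: i; j; k] by rewrite rt.
have ikjP : perm_eq [:: i; k; j] [:: i; j; k] by rewrite sw.
have kjiP : perm_eq [:: k; j; i] [:: i; j; k] by rewrite sw.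
by rewrite /det3 !mulrBr !nil // !subrr addr0.
Qed.

Lemma tri_std_out P a b c :
  (forall q, q \in P ->
     ~~ perm_eq [:: a; b; c] [:: q.1.1.1; q.1.1.2; q.1.2]) ->
  tri P (std a) (std b) (std c) = 0.
Proof.
by move=> out; rewrite /tri big_seq big1 // => q /out/det3_std_out->; rewrite mulr0.
Qed.

Lemma tri_std_in P a b c v : irredundant P -> (a, b, c, v) \in P ->
  tri P (std a) (std b) (std c) = v.
Proof.
case/andP; elim: P => //= q P IHP /andP[uq uP] /andP[/allP nq pw].
rewrite inE /tri big_cons => /orP[/eqP Eq | qP]; last first.
  rewrite [X in _ + X]IHP // det3_std_out ?mulr0 ?add0r //.
  by rewrite perm_sym (nq _ qP).
rewrite -/(tri P _ _ _) tri_std_out => [|q' q'P]; last by have:= nq _ q'P; rewrite -Eq.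
move: uq; rewrite -Eq /= !inE !negb_or addr0 /det3 /std !eqxx 
  => /and3P[/andP[ab ac] bc _].
rewrite ![b == a]eq_sym ![c == a]eq_sym ![c == b]eq_sym.
rewrite (negPf ab) (negPf ac) (negPf bc) /=; ring.
Qed.

End Forms.

Arguments std {F} a b.

(** * Coordinates with respect to a standard basis *)

Section Coordinates.

Variables (F : fieldType) (L : saa F).
Implicit Types (e : label -> L) (u v w : L) (P : presentation F).

Lemma sform_skew u v : sform L u v = - sform L v u.
Proof.
apply/eqP; rewrite -addr_eq0; apply/eqP.
by have:= sform_alt (u + v); rewrite linearDl !linearDr /= !sform_alt add0r addr0.
Qed.

Lemma smul_skew u v : smul L u v = - smul L v u.
Proof.
apply/eqP; rewrite -addr_eq0; apply/eqP.
by have:= smul_alt (u + v); rewrite linearDl !linearDr /= !smul_alt add0r addr0.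
Qed.

Definition triple u v w : F := sform L (smul L u v) w.

Lemma triple_cyclic u v w : triple u v w = triple v w u.
Proof. exact: saa_cyclic. Qed.

Lemma triple_swap u v w : triple v u w = - triple u v w.
Proof. by rewrite /triple smul_skew linearNl. Qed.

Definition crd e u (a : label) : F :=
  match a with
  | inl i => sform L u (e (inr i))
  | inr i => sform L (e (inl i)) u
  end.

Lemma crd_linear e c u v : crd e (c *: u + v) =1 fun a => c * crd e u a + crd e v a.
Proof.
by case=> i /=; rewrite ?linearDl ?linearDr ?linearZl_LR ?linearZr_LR.
Qed.

Lemma crd_stdE e :
  (forall i j, sform L (e (inl i)) (e (inl j)) = 0) ->
  (forall i j, sform L (e (inr i)) (e (inr j)) = 0) ->
  (forall i j, sform L (e (inl i)) (e (inr j)) = (i == j)%:R) ->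
  forall a, crd e (e a) =1 std a.
Proof.
move=> exx eyy exy; case=> i; case=> j; rewrite /std /= ?exx ?eyy ?exy //.
by rewrite eq_sym.
Qed.

Lemma crd_std e a : standard_basis e -> crd e (e a) =1 std a.
Proof. by case=> _ exx eyy exy; apply: crd_stdE. Qed.

Lemma crd_sum e (k : label -> F) : (forall a, crd e (e a) =1 std a) ->
  crd e (\sum_b k b *: e b) =1 k.
Proof.
move=> eP a.
have ->: crd e (\sum_b k b *: e b) a = \sum_b k b * crd e (e b) a.
  case: a => i /=; rewrite ?linear_sumlz ?linear_sumr.
    by apply: eq_bigr => b _; rewrite linearZl_LR.
  by apply: eq_bigr => b _; rewrite linearZr_LR.
rewrite (bigD1 a) //= eP /std eqxx mulr1 big1 ?addr0 // => b nba.
by rewrite eP /std (negPf nba) mulr0.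
Qed.

Lemma standard_basisE e u : standard_basis e -> u = \sum_b crd e u b *: e b.
Proof.
move=> eP; have [eB _ _ _] := eP.
suff [k uE]: exists k : label -> F, u = \sum_b k b *: e b.
  by rewrite {1}uE; apply: eq_bigr => b _; rewrite uE crd_sum // => a; apply: crd_std.
have uX := coord_basis (X := codom_tuple e) eB (memvf u).
exists (fun b => coord (codom_tuple e) (enum_rank b) u).
rewrite {1}uX (reindex enum_rank) /=; last exact/onW_bij/enum_rank_bij.
by apply: eq_bigr => b _; rewrite nth_codom enum_rankK.
Qed.

Lemma big_label (V : nmodType) (f : label -> V) :
  \sum_a f a = f x1 + f x2 + f x3 + f x4 + f x5 + (f y1 + f y2 + f y3 + f y4 + f y5).
Proof.
rewrite big_sumType /= !big_ord_recl !big_ord0 /= !addr0 !addrA.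
by do !congr (_ + _); congr f; congr (_ _); apply: val_inj.
Qed.

Lemma standard_basis_omega e u v : standard_basis e ->
  sform L u v = omega (crd e u) (crd e v).
Proof.
move=> eP; rewrite {1}(standard_basisE u eP) big_label !linearDl /= !linearZl_LR /=.
rewrite /omega /crd /= -!/(crd _ _ _) ![sform L (e (inr _)) v]sform_skew; ring.
Qed.

(** Keeping the basis explicit makes it possible to compose changes of basis. *)
Definition presented e P : Prop :=
  [/\ standard_basis e,
      forall a b c t, (a, b, c, t) \in P -> sform L (smul L (e a) (e b)) (e c) = t
    & forall a b c,
        (forall a' b' c' t, (a', b', c', t) \in P ->
           ~~ perm_eq [:: a; b; c] [:: a'; b'; c']) ->
        sform L (smul L (e a) (e b)) (e c) = 0].

(** The relations list one order of each triple; the other five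
    follow since both sides are alternating. *)
Lemma presented_std e P a b c : irredundant P -> presented e P ->
  triple (e a) (e b) (e c) = tri P (std a) (std b) (std c).
Proof.
move=> wfP [eP inP outP].
have rt i j k : triple (e i) (e j) (e k) = tri P (std i) (std j) (std k) ->
    triple (e j) (e k) (e i) = tri P (std j) (std k) (std i).
  by move=> E; rewrite -triple_cyclic E tri_cyclic.
have sw i j k : triple (e i) (e j) (e k) = tri P (std i) (std j) (std k) ->
    triple (e j) (e i) (e k) = tri P (std j) (std i) (std k).
  by move=> E; rewrite triple_swap E [RHS]tri_swap.
have [/hasP[q qP]|/hasPn nP] := boolP (has (fun q =>
    perm_eq [:: a; b; c] [:: q.1.1.1; q.1.1.2; q.1.2]) P); last first.
  rewrite /triple outP ?tri_std_out // => a' b' c' v qP; exact: (nP _ qP).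
case: q qP => [[[i j] k] v] qP /= abc.
have Tq : triple (e i) (e j) (e k) = tri P (std i) (std j) (std k).
  by rewrite (tri_std_in wfP qP); apply: inP.
have : a \in [:: i; j; k] by rewrite -(perm_mem abc) mem_head.
have one (x y : label) : perm_eq [:: x] [:: y] -> x = y.
  by move=> /perm_mem/(_ x); rewrite mem_head inE => /esym/eqP.
have two (x y z t : label) : perm_eq [:: x; y] [:: z; t] ->
    x = z /\ y = t \/ x = t /\ y = z.
  move=> xyP; have : x \in [:: z; t] by rewrite -(perm_mem xyP) mem_head.
  rewrite !inE => /orP[]/eqP Ex; move: xyP; rewrite Ex.
    by rewrite perm_cons => /one->; left.
  by rewrite (permPr (permEl (perm_catC [:: z] [:: t]))) perm_cons => /one->; right.
rewrite !inE => /or3P[]/eqP Ea; move: abc; rewrite Ea.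
- by rewrite perm_cons => /two[][-> ->] //; apply/rt/sw.
- rewrite (permPr (permEl (perm_catCA [:: i] [:: j] [:: k]))) perm_cons
    => /two[][-> ->].
    exact: sw.
  exact: rt.
- rewrite (permPr (permEl (perm_catC [:: i; j] [:: k]))) perm_cons
    => /two[][-> ->].
    exact/rt/rt.
  exact/sw/rt.
Qed.

Lemma triple_linear c u u' v w :
  triple (c *: u + u') v w = c * triple u v w + triple u' v w.
Proof. by rewrite /triple !linearDl !linearZl_LR. Qed.

Lemma linear_ext_basis e (f g : L -> F) : standard_basis e ->
  (forall c u v, f (c *: u + v) = c * f u + f v) ->
  (forall c u v, g (c *: u + v) = c * g u + g v) ->
  (forall a, f (e a) = g (e a)) -> f =1 g.
Proof.
have lin_sum (h : L -> F) k : (forall c u v, h (c *: u + v) = c * h u + h v) ->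
    h (\sum_b k b *: e b) = \sum_b k b * h (e b).
  move=> hL; have h0 : h 0 = 0.
    have := hL 1 0 0; rewrite scaler0 addr0 mul1r => /eqP.
    by rewrite -[X in X == _]addr0 (inj_eq (addrI _)) => /eqP.
  by apply: (big_rec2 (fun u r => h u = r)) => // b u r _ <-; rewrite hL.
move=> eP fL gL fg u; rewrite (standard_basisE u eP) !lin_sum //.
by apply: eq_bigr => b _; rewrite fg.
Qed.

(** Both sides are trilinear, so it is enough to compare them on the basis. *)
Lemma presented_tri e P u v w : irredundant P -> presented e P ->
  triple u v w = tri P (crd e u) (crd e v) (crd e w).
Proof.
move=> wfP PP; have [eP _ _] := PP.
have triL c u1 u2 v1 w1 : tri P (crd e (c *: u1 + u2)) (crd e v1) (crd e w1) =
    c * tri P (crd e u1) (crd e v1) (crd e w1) + tri P (crd e u2) (crd e v1) (crd e w1).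
  rewrite -tri_linear; apply: tri_ext => // a; exact: crd_linear.
move: u; apply: (linear_ext_basis eP) => [c u1 u2|c u1 u2|a];
  rewrite ?triple_linear ?triL //.
rewrite triple_cyclic tri_cyclic.
move: v; apply: (linear_ext_basis eP) => [c v1 v2|c v1 v2|b];
  rewrite ?triple_linear ?triL //.
rewrite triple_cyclic tri_cyclic.
move: w; apply: (linear_ext_basis eP) => [c w1 w2|c w1 w2|d];
  rewrite ?triple_linear ?triL //.
rewrite (presented_std _ _ _ wfP PP).
by apply: tri_ext => i; rewrite crd_std.
Qed.

(** The pairing with the dual basis recovers the coefficients of a linear
    combination. *)
Lemma standard_free e :
  (forall a, crd e (e a) =1 std a) -> free (codom e).
Proof.
move=> eP; suff: free (codom_tuple e) by [].
apply/freeP => k; rewrite (reindex enum_rank) /=; last exact/onW_bij/enum_rank_bij.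
under eq_bigr do rewrite nth_codom enum_rankK.
move=> k0 i; rewrite -(enum_valK i) -(crd_sum (fun a => k (enum_rank a)) eP) k0 /crd.
by case: (enum_val i) => j; rewrite ?linear0r ?linear0l.
Qed.

(** The substitution N expresses old coordinates through new ones: the vector
    with new coordinates al has old coordinates N al. *)
Definition new_basis e (N : (label -> F) -> label -> F) (a : label) : L :=
  \sum_b N (std a) b *: e b.

(** Only two identities between polynomials in generic coordinates are
    required; the dimension gives that the new vectors span. *)
Lemma change_of_basis e P Q N : irredundant P -> irredundant Q -> presented e P ->
  (forall al be, omega (N al) (N be) = omega al be) ->
  (forall al be ka, tri P (N al) (N be) (N ka) = tri Q al be ka) ->
  presented (new_basis e N) Q.
Proof.
move=> wfP wfQ PP NO NT; have [eP _ _] := PP; have [eB exx eyy exy] := eP.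
have cN a : crd e (new_basis e N a) =1 N (std a).
  by apply: crd_sum => b; apply: crd_std.
have sN a b : sform L (new_basis e N a) (new_basis e N b) = sform L (e a) (e b).
  rewrite !(standard_basis_omega _ _ eP) (omega_ext (cN a) (cN b)) NO.
  by apply: omega_ext => c; rewrite crd_std.
have tN a b c : triple (new_basis e N a) (new_basis e N b) (new_basis e N c)
    = tri Q (std a) (std b) (std c).
  by rewrite (presented_tri _ _ _ wfP PP) (tri_ext _ (cN a) (cN b) (cN c)) NT.
split=> [|a b c t|a b c out]; last 2 first.
- by move=> /(tri_std_in wfQ) <-; apply: tN.
- rewrite -/(triple _ _ _) tN tri_std_out // => -[[[i j] k] t]; exact: out.
split=> [|i j|i j|i j]; rewrite ?sN //.
rewrite basisEfree subvf /= standard_free /=; last first.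
  by apply: crd_stdE => i j; rewrite sN.
by rewrite size_codom (size_basis (X := codom_tuple e) eB).
Qed.

End Coordinates.

(** * Two families of symplectic substitutions *)

Section Changes.

Variable F : fieldType.
Implicit Types (al be ka : label -> F).

Definition coords (a1 a2 a3 a4 a5 b1 b2 b3 b4 b5 : F) : label -> F := fun l =>
  match l with
  | inl i => nth 0 [:: a1; a2; a3; a4; a5] i
  | inr i => nth 0 [:: b1; b2; b3; b4; b5] i
  end.

(** The term at x2 y4 y5 and a tensor on W x N x V, with W = <x1, y1>,
    N = <y2, y3> and V = <y4, y5>. *)
Definition reduced (g f14 f15 f24 f25 g14 g15 g24 g25 : F) : presentation F :=
  [:: (x2, y4, y5, g);
      (x1, y2, y4, f14); (x1, y2, y5, f15); (y1, y2, y4, f24); (y1, y2, y5, f25);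
      (x1, y3, y4, g14); (x1, y3, y5, g15); (y1, y3, y4, g24); (y1, y3, y5, g25)].

(** The support that the central series allows in an adapted basis. *)
Definition filtered (g f14 f15 f24 f25 g14 g15 g24 g25 h1 h2 b4 b5 d2 d3 : F) :
    presentation F :=
  reduced g f14 f15 f24 f25 g14 g15 g24 g25 ++
  [:: (x1, y4, y5, h1); (y1, y4, y5, h2); (y2, y3, y4, b4); (y2, y3, y5, b5);
      (y2, y4, y5, d2); (y3, y4, y5, d3)].

Lemma irredundant_P10_3_9 g r s : irredundant (P10_3_9 g r s : presentation F).
Proof. by []. Qed.

Lemma tri_P10_3_9 g r s al be ka :
  tri (P10_3_9 g r s) al be ka = tri (reduced g 1 0 0 1 r s 1 0) al be ka.
Proof. by rewrite /tri !big_cons !big_nil /=; ring. Qed.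

Lemma tri_filtered g f14 f15 f24 f25 g14 g15 g24 g25 al be ka :
  tri (filtered g f14 f15 f24 f25 g14 g15 g24 g25 0 0 0 0 0 0) al be ka =
  tri (reduced g f14 f15 f24 f25 g14 g15 g24 g25) al be ka.
Proof. by rewrite /tri !big_cons !big_nil /=; ring. Qed.

(** Coordinates for the new basis vectors x1 + k1 x2 - q x3,
    y1 + k2 x2 + p x3, y2 + k2 x1 - k1 y1 + C x2 + (D - k2 q - k1 p) x3 and
    y3 + p x1 + q y1 + D x2, the others being unchanged: k1 and k2 serve to
    remove the triples in W x V x V, then p and q those in N x N x V, then C
    and D those in N x V x V. *)
Definition unipotent (k1 k2 p q C D : F) al : label -> F :=
  coords
    (al x1 + k2 * al y2 + p * al y3)
    (al x2 + k1 * al x1 + k2 * al y1 + C * al y2 + D * al y3)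
    (al x3 - q * al x1 + p * al y1 + (D - k2 * q - k1 * p) * al y2)
    (al x4) (al x5)
    (al y1 - k1 * al y2 + q * al y3) (al y2) (al y3) (al y4) (al y5).

Lemma unipotent_omega k1 k2 p q C D al be :
  omega (unipotent k1 k2 p q C D al) (unipotent k1 k2 p q C D be) = omega al be.
Proof. by rewrite /omega /=; ring. Qed.

Lemma unipotent_tri k1 k2 p q C D g f14 f15 f24 f25 g14 g15 g24 g25 h1 h2 b4 b5 d2 d3
    al be ka :
  let N := unipotent k1 k2 p q C D in
  tri (filtered g f14 f15 f24 f25 g14 g15 g24 g25 h1 h2 b4 b5 d2 d3)
      (N al) (N be) (N ka) =
  tri (filtered g f14 f15 f24 f25 g14 g15 g24 g25
         (h1 + k1 * g) (h2 + k2 * g)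
         (b4 - p * f14 - q * f24 + k2 * g14 - k1 * g24)
         (b5 - p * f15 - q * f25 + k2 * g15 - k1 * g25)
         (d2 + k2 * h1 - k1 * h2 + C * g) (d3 + p * h1 + q * h2 + D * g)) al be ka.
Proof. by rewrite /tri !big_cons !big_nil /det3 /=; ring. Qed.

(** Coordinates for the block diagonal change to p' x1 + q' y1 and
    p x1 + q y1 on W, to c y2 and a y3 + b y2 on N, and to P x4 + Q x5 and
    R x4 + S x5 on <x4, x5>; the blocks on <x2, x3> and on V are the dual ones. *)
Definition levi (p' q' p q a b c P Q R S : F) al : label -> F :=
  let D := P * S - Q * R in
  coords
    (p' * al x1 + p * al y1) (al x2 / c) (al x3 / a - b / (a * c) * al x2)
    (P * al x4 + R * al x5) (Q * al x4 + S * al x5)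
    (q' * al x1 + q * al y1) (c * al y2 + b * al y3) (a * al y3)
    ((S * al y4 - Q * al y5) / D) ((P * al y5 - R * al y4) / D).

(** Block diagonal matrices with dual blocks are symplectic when the block on
    W has determinant 1, a symplectic plane having no dual block to absorb
    it. *)
Lemma levi_omega p' q' p q a b c P Q R S al be :
  a != 0 -> c != 0 -> P * S - Q * R != 0 -> p' * q - q' * p = 1 ->
  omega (levi p' q' p q a b c P Q R S al) (levi p' q' p q a b c P Q R S be) =
  omega al be.
Proof.
move=> a0 c0 D0 det1.
transitivity (omega al be + (p' * q - q' * p - 1) * (al x1 * be y1 - al y1 * be x1)).
  by rewrite /omega /=; field; rewrite a0 c0 D0.
by rewrite det1 subrr mul0r addr0.
Qed.

Lemma levi_tri p' q' p q a b c P Q R S g f14 f15 f24 f25 g14 g15 g24 g25 al be ka :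
  a != 0 -> c != 0 -> P * S - Q * R != 0 ->
  let N := levi p' q' p q a b c P Q R S in
  let D := P * S - Q * R in
  let f1u := c * (p' * f14 + q' * f24) in let f1v := c * (p' * f15 + q' * f25) in
  let f2u := c * (p * f14 + q * f24) in let f2v := c * (p * f15 + q * f25) in
  let g1u := b * (p' * f14 + q' * f24) + a * (p' * g14 + q' * g24) in
  let g1v := b * (p' * f15 + q' * f25) + a * (p' * g15 + q' * g25) in
  let g2u := b * (p * f14 + q * f24) + a * (p * g14 + q * g24) in
  let g2v := b * (p * f15 + q * f25) + a * (p * g15 + q * g25) in
  tri (reduced g f14 f15 f24 f25 g14 g15 g24 g25) (N al) (N be) (N ka) =
  tri (reduced (g / (c * D))
    ((S * f1u - R * f1v) / D) ((P * f1v - Q * f1u) / D)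
    ((S * f2u - R * f2v) / D) ((P * f2v - Q * f2u) / D)
    ((S * g1u - R * g1v) / D) ((P * g1v - Q * g1u) / D)
    ((S * g2u - R * g2v) / D) ((P * g2v - Q * g2u) / D)) al be ka.
Proof.
move=> a0 c0 D0 /=.
by rewrite /tri !big_cons !big_nil /det3 /=; field; rewrite c0 D0.
Qed.

End Changes.

(** * The algebra with a given presentation *)

Section Model.

Variables (F : fieldType) (P : presentation F).

Definition model_space : vectType F := {ffun label -> F^o}.
Implicit Types u v w : model_space.

Definition model_basis (a : label) : model_space := [ffun b => std a b].

Definition model_form u v : F := omega u v.

Definition model_mul u v : model_space :=
  [ffun a => match a with
             | inl i => tri P u v (std (inr i))
             | inr i => - tri P u v (std (inl i))
             end].

Let model_spaceE c u v : (c *: u + v : model_space) =1 fun a => c * u a + v a.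
Proof. by move=> a; rewrite !ffunE. Qed.

Fact model_form_bilinear : bilinear_for *%R *%R model_form.
Proof.
split=> w c u v; rewrite /model_form.
  by rewrite (omega_ext (model_spaceE c u v) (frefl w)) /omega /=; ring.
by rewrite (omega_ext (frefl w) (model_spaceE c u v)) /omega /=; ring.
Qed.

HB.instance Definition _ :=
  bilinear_isBilinear.Build F model_space model_space F
    *%R *%R model_form model_form_bilinear.

Fact model_mul_bilinear : bilinear_for *:%R *:%R model_mul.
Proof.
have triL c u v (f h : label -> F) :
    tri P ((c *: u + v : model_space) : label -> F) f h = c * tri P u f h + tri P v f h.
  by rewrite -tri_linear; apply: tri_ext => // a; rewrite !ffunE.
have triR c u v (f h : label -> F) :
    tri P f ((c *: u + v : model_space) : label -> F) h = c * tri P f u h + tri P f v h.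
  by rewrite tri_cyclic triL [tri P f u h]tri_cyclic [tri P f v h]tri_cyclic.
split=> w c u v; apply/ffunP => -[] i; rewrite !ffunE /= ?triL ?triR //.
  by rewrite opprD -mulrN.
by rewrite opprD -mulrN.
Qed.

HB.instance Definition _ :=
  bilinear_isBilinear.Build F model_space model_space model_space
    *:%R *:%R model_mul model_mul_bilinear.

Lemma model_form_std u a :
  model_form u (model_basis a) =
  match a with inl i => - u (inr i) | inr i => u (inl i) end.
Proof.
rewrite /model_form /omega !ffunE /std.
by case: a => -[[|[|[|[|[|//]]]]] lti] /=;
   rewrite ?mulr0 ?mulr1 ?subr0 ?sub0r ?addr0 ?add0r; congr (u _) || congr (- u _);
   congr (_ _); apply: val_inj.
Qed.

Lemma model_form_mul u v w : model_form (model_mul u v) w = tri P u v w.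
Proof.
transitivity (\sum_a w a * tri P u v (std a)).
  rewrite big_label /model_form /omega !ffunE /=.
  by rewrite -/x1 -/x2 -/x3 -/x4 -/x5 -/y1 -/y2 -/y3 -/y4 -/y5; ring.
rewrite /tri; under eq_bigr do rewrite mulr_sumr.
rewrite exchange_big /=; apply: eq_bigr => q _.
have S i : \sum_a w a * std a i = w i.
  rewrite (bigD1 i) //= /std eqxx mulr1 big1 ?addr0 // => a nai.
  by rewrite (negPf nai) mulr0.
rewrite /det3 -(S q.1.1.1) -(S q.1.1.2) -(S q.1.2) !mulr_sumr -!sumrB !mulr_sumr.
rewrite -sumrB -big_split /= mulr_sumr; apply: eq_bigr => a _; ring.
Qed.

Fact model_form_alt u : model_form u u = 0.
Proof. by rewrite /model_form /omega; ring. Qed.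

Fact model_form_nondeg u : (forall v, model_form u v = 0) -> u = 0.
Proof.
move=> u0; apply/ffunP => -[] i; rewrite ffunE.
  by rewrite -(u0 (model_basis (inr i))) model_form_std.
by apply: oppr_inj; rewrite oppr0 -(u0 (model_basis (inl i))) model_form_std.
Qed.

Fact model_mul_alt u : model_mul u u = 0.
Proof.
have tri0 f : tri P u u f = 0.
  by rewrite /tri big1 // => q _; rewrite /det3; ring.
by apply/ffunP => -[] i; rewrite !ffunE tri0 ?oppr0.
Qed.

Fact model_form_cyclic u v w :
  model_form (model_mul u v) w = model_form (model_mul v w) u.
Proof. by rewrite !model_form_mul tri_cyclic. Qed.

(** The product is defined by duality: uv is the vector that represents the
    linear form w |-> tri P u v w. *)
Definition model : saa F :=
  Saa model_form_alt model_form_nondeg model_mul_alt model_form_cyclic.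

Lemma model_form_basis a b : model_form (model_basis a) (model_basis b) =
  match a, b with
  | inl i, inr j => (i == j)%:R
  | inr i, inl j => - (i == j)%:R
  | _, _ => 0
  end.
Proof. by rewrite model_form_std; case: a b => i [] j; rewrite !ffunE /std ?oppr0. Qed.

Lemma model_presented : irredundant P -> presented (L := model) model_basis P.
Proof.
move=> wfP; have tP a b c :
    model_form (model_mul (model_basis a) (model_basis b)) (model_basis c) =
    tri P (std a) (std b) (std c).
  by rewrite model_form_mul; apply: tri_ext => i; rewrite ffunE.
split=> [|a b c t abcP|a b c out]; last 2 first.
- by rewrite -(tri_std_in wfP abcP) -tP.
- by rewrite [LHS]tP tri_std_out // => -[[[i j] k] t]; apply: out.
split=> [|i j|i j|i j]; try by rewrite [LHS]model_form_basis.
rewrite /basis_of standard_free ?andbT; last first.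
  by apply: crd_stdE => i j; rewrite [LHS]model_form_basis.
rewrite eqEsubv subvf /=; apply/subvP=> /= u _.
have ->: u = \sum_a (u a : F) *: model_basis a.
  apply/ffunP => b; rewrite sum_ffunE (bigD1 b) //= big1 => [|a nab].
    by rewrite !ffunE /std eqxx addr0 /GRing.scale /= mulr1.
  by rewrite !ffunE /std (negPf nab) /GRing.scale /= mulr0.
by apply: memv_suml => a _; rewrite memvZ // memv_span // codom_f.
Qed.

End Model.

Lemma saa_isomorphic_refl (F : fieldType) (L : saa F) : saa_isomorphic L L.
Proof. by exists idfun; split=> //; exists idfun. Qed.

(** * Algebras with two presentations *)

Section Sufficiency.

Variable F : fieldType.
Hypothesis charF2 : 2%N \in [pchar F].

(** If n = r' / r = X^2 + r X Y + s Y^2, then (X / n, Y / n) represents 1 / n,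
    which supplies the row (p, q) of the block on W with c / a = 1 / n; a
    cube root of gamma / gamma' is c, and b / c is the element that exhibits
    the membership in H.  The vectors x4 and x5 are then forced to be y1 y3
    and y1 y2 for the new y1, y2, y3. *)
Lemma P10_3_9_same (g r s g' r' s' : F) :
  admissible g r s -> admissible g' r' s' ->
  nonzero_cube (g' / g) -> in_G r s (r' / r) ->
  in_H r' (s' - (r' / r) ^+ 2 * s) ->
  same_algebra (P10_3_9 g' r' s') (P10_3_9 g r s).
Proof.
case=> g0 r0 _ [g'0 r'0 _] [z z0 gE] [X [Y [_ nE]]] [h sE].
set n := r' / r in nE sE.
have n0 : n != 0 by rewrite mulf_neq0 ?invr_eq0.
have r'E : r' = n * r by rewrite /n divfK.
have g'E : g' = z ^+ 3 * g by rewrite -gE divfK.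
pose q := X / n; pose p := Y / n; pose c := z^-1; pose a := c * n; pose b := c * h.
(* The norm form represents 1 / n at (q, p). *)
have norm1 : n * (q ^+ 2 + r * p * q - s * p ^+ 2) = 1.
  rewrite -mulNr (oppr_pchar2 charF2).
  transitivity ((X ^+ 2 + r * X * Y + s * Y ^+ 2) / n); last by rewrite -nE divff.
  by rewrite /q /p; field.
pose p' := n * (p * r + q) + h * p; pose q' := n * p * s + h * q.
have det1 : p' * q - q' * p = 1 by rewrite -norm1 /p' /q'; ring.
have c0 : c != 0 by rewrite invr_eq0.
have a0 : a != 0 by rewrite mulf_neq0.
pose N := levi p' q' p q a b c (c * p') (c * q') (c * p) (c * q).
have D1 : c * p' * (c * q) - c * q' * (c * p) = c ^+ 2.
  by rewrite -[RHS]mulr1 -det1; ring.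
have D0 : c * p' * (c * q) - c * q' * (c * p) != 0 by rewrite D1 expf_neq0.
exists (model (P10_3_9 g r s)), (model (P10_3_9 g r s)).
have PP := model_presented (irredundant_P10_3_9 g r s).
split; [|by exists (@model_basis F)|exact: saa_isomorphic_refl].
exists (new_basis (L := model (P10_3_9 g r s)) (@model_basis F) N).
apply: change_of_basis PP _ _ => // al be; first exact: levi_omega.
move=> ka; rewrite !tri_P10_3_9 levi_tri //= D1.
have r'N : h * (p' * q - q' * p) + n * (p' * r * q + q' * q - p * p' * s) = r'.
  transitivity (h + (h + n * r) * (n * (q ^+ 2 + r * p * q - s * p ^+ 2))).
    by rewrite det1 /p' /q'; ring.
  by rewrite norm1 mulr1 addrA (addrr_pchar2 charF2) add0r r'E.
have s'N : n * (p' ^+ 2 * s - p' * q' * r - q' ^+ 2) = s'.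
  transitivity (- (h ^+ 2 + r * h * n - s * n ^+ 2) *
                (n * (q ^+ 2 + r * p * q - s * p ^+ 2))).
    by rewrite /p' /q'; ring.
  rewrite norm1 mulr1 (oppr_pchar2 charF2).
  rewrite -(subrK (n ^+ 2 * s) s') sE r'E (oppr_pchar2 charF2); ring.
have c20 : c ^+ 2 != 0 by rewrite expf_neq0.
have div1 x y : x = y * c ^+ 2 -> x / c ^+ 2 = y by move->; rewrite mulfK.
have div2 x y : x = y * c ^+ 2 * (p' * q - q' * p) -> x / c ^+ 2 = y.
  by rewrite det1 mulr1; apply: div1.
congr (tri (reduced _ _ _ _ _ _ _ _ _) al be ka).
- by rewrite g'E /c -exprS -exprVn invrK mulrC.
- by apply: div2; ring.
- by apply: div1; ring.
- by apply: div1; ring.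
- by apply: div2; ring.
- by apply: div1; rewrite -r'N /b /a; ring.
- by apply: div1; rewrite -s'N /b /a; ring.
- by apply: div2; rewrite /p' /q' /b /a; ring.
- by apply: div1; rewrite /p' /q' /b /a; ring.
Qed.

End Sufficiency.

(** * The upper central series of a presented algebra *)

Section CentralSeries.

Variables (F : fieldType) (L : saa F) (e : label -> L) (g r s : F).
Hypotheses (g0 : g != 0) (eP : presented e (P10_3_9 g r s)).

Let P : presentation F := P10_3_9 g r s.
Let eB : standard_basis e. Proof. by case: eP. Qed.

Definition dual_label (a : label) : label :=
  match a with inl i => inr i | inr i => inl i end.

Lemma crd0 u : (forall a, crd e u a = 0) -> u = 0.
Proof.
by move=> u0; rewrite (standard_basisE u eB) big1 // => a _; rewrite u0 scale0r.
Qed.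

Lemma crd_smul u v a :
  (crd e (smul L u v) a == 0) = (tri P (crd e u) (crd e v) (std (dual_label a)) == 0).
Proof.
have triE c : triple u v (e c) = tri P (crd e u) (crd e v) (std c).
  rewrite (presented_tri _ _ _ (irredundant_P10_3_9 _ _ _) eP).
  by apply: tri_ext => // b; rewrite crd_std.
case: a => i /=; rewrite -triE //.
by rewrite sform_skew oppr_eq0.
Qed.

(** A vector u is in the next term iff all the products u v are in the given
    one, and the coordinate a of u v is, up to sign, the triple product of u, v
    and the basis vector dual to a. *)
Lemma ucs_crd_step k (S S' : seq label) :
  (forall u, u \in ucs L k <-> {in S, forall a, crd e u a = 0}) ->
  (forall al, (forall b, {in S, forall a, tri P al (std b) (std (dual_label a)) = 0}) ->
    {in S', forall a, al a = 0}) ->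
  (forall al be, {in S', forall a, al a = 0} ->
    {in S, forall a, tri P al be (std (dual_label a)) = 0}) ->
  forall u, u \in ucs L k.+1 <-> {in S', forall a, crd e u a = 0}.
Proof.
move=> kS fwd bwd u; split=> [/memv_ucsS uk | u0].
  apply: fwd => b a aS; apply/eqP.
  rewrite -(tri_ext P (frefl _) (crd_std b eB) (frefl _)) -crd_smul.
  by apply/eqP; move: aS; apply: (kS _).1.
apply/memv_ucsS => v; apply/kS => a aS; apply/eqP; rewrite crd_smul; apply/eqP.
exact: bwd aS.
Qed.

Ltac tri_simpl := rewrite /P /tri !big_cons big_nil /det3 /std /=; ring.

Lemma tri_x2 al : tri P al (std y4) (std y5) = g * al x2. Proof. tri_simpl. Qed.
Lemma tri_x1 al : tri P al (std y4) (std y2) = - al x1. Proof. tri_simpl. Qed.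
Lemma tri_y1 al : tri P al (std y5) (std y2) = - al y1. Proof. tri_simpl. Qed.
Lemma tri_y2 al : tri P al (std y4) (std x1) = al y2 + r * al y3. Proof. tri_simpl. Qed.
Lemma tri_y3 al : tri P al (std y4) (std y1) = al y3. Proof. tri_simpl. Qed.
Lemma tri_y4 al : tri P al (std y5) (std x2) = g * al y4. Proof. tri_simpl. Qed.
Lemma tri_y5 al : tri P al (std y4) (std x2) = - g * al y5. Proof. tri_simpl. Qed.

Definition ucs_cut (k : nat) : seq label :=
  nth [::] [:: [:: x1; x2; x3; x4; x5; y1; y2; y3; y4; y5];
               [:: x1; x2; y1; y2; y3; y4; y5]; [:: x1; y1; y2; y3; y4; y5];
               [:: y2; y3; y4; y5]; [:: y4; y5]] k.

Lemma ucs_crd k u : (k <= 4)%N ->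
  u \in ucs L k <-> {in ucs_cut k, forall a, crd e u a = 0}.
Proof.
have c0 : forall u, u \in ucs L 0 <-> {in ucs_cut 0, forall a, crd e u a = 0}.
  move=> {}u; rewrite memv0; split=> [/eqP-> a _ | u0].
    by case: a => i /=; rewrite ?linear0l ?linear0r.
  apply/eqP/crd0 => a; apply: u0.
  by case: a => -[[|[|[|[|[|//]]]]] lti].
have gI x : g * x = 0 -> x = 0.
  by move/eqP; rewrite mulf_eq0 (negPf g0) => /eqP.
have gNI x : - g * x = 0 -> x = 0.
  by rewrite mulNr => /eqP; rewrite oppr_eq0 => /eqP/gI.
have nI (x : F) : - x = 0 -> x = 0 by move/eqP; rewrite oppr_eq0 => /eqP.
have y2I (x y : F) : x + r * y = 0 -> y = 0 -> x = 0.
  by move=> + y0; rewrite y0 mulr0 addr0.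
have hy3 al : tri P al (std y4) (std y1) = 0 -> al y3 = 0 by rewrite tri_y3.
have hy2 al : tri P al (std y4) (std y1) = 0 -> tri P al (std y4) (std x1) = 0 ->
  al y2 = 0 by rewrite tri_y2 => /hy3 h3 h2; apply: y2I h2 h3.
have hy4 al : tri P al (std y5) (std x2) = 0 -> al y4 = 0.
  by rewrite tri_y4 => /gI.
have hy5 al : tri P al (std y4) (std x2) = 0 -> al y5 = 0.
  by rewrite tri_y5 => /gNI.
have hx1 al : tri P al (std y4) (std y2) = 0 -> al x1 = 0.
  by rewrite tri_x1 => /nI.
have hy1 al : tri P al (std y5) (std y2) = 0 -> al y1 = 0.
  by rewrite tri_y1 => /nI.
have hx2 al : tri P al (std y4) (std y5) = 0 -> al x2 = 0.
  by rewrite tri_x2 => /gI.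
have c1 : forall u, u \in ucs L 1 <-> {in ucs_cut 1, forall a, crd e u a = 0}.
  apply: ucs_crd_step c0 _ _ => al.
    move=> H a; rewrite !inE; do ?[case/orP]; move/eqP->.
    - exact: hx1 (H y4 x2 isT).
    - exact: hx2 (H y4 x5 isT).
    - exact: hy1 (H y5 x2 isT).
    - exact: hy2 (H y4 x1 isT) (H y4 y1 isT).
    - exact: hy3 (H y4 x1 isT).
    - exact: hy4 (H y5 y2 isT).
    - exact: hy5 (H y4 y2 isT).
  move=> be z a _.
  have [zx1 zx2] := (z x1 isT, z x2 isT).
  have [zy1 zy2 zy3 zy4 zy5] :=
    And5 (z y1 isT) (z y2 isT) (z y3 isT) (z y4 isT) (z y5 isT).
  rewrite /P /tri !big_cons big_nil /det3 /= zx1 zx2 zy1 zy2 zy3 zy4 zy5; ring.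
have c2 : forall u, u \in ucs L 2 <-> {in ucs_cut 2, forall a, crd e u a = 0}.
  apply: ucs_crd_step c1 _ _ => al.
    move=> H a; rewrite !inE; do ?[case/orP]; move/eqP->.
    - exact: hx1 (H y4 x2 isT).
    - exact: hy1 (H y5 x2 isT).
    - exact: hy2 (H y4 x1 isT) (H y4 y1 isT).
    - exact: hy3 (H y4 x1 isT).
    - exact: hy4 (H y5 y2 isT).
    - exact: hy5 (H y4 y2 isT).
  move=> be z a; have zx1 := z x1 isT.
  have [zy1 zy2 zy3 zy4 zy5] :=
    And5 (z y1 isT) (z y2 isT) (z y3 isT) (z y4 isT) (z y5 isT).
  rewrite !inE; do ?[case/orP]; move/eqP->;
  rewrite /P /tri !big_cons big_nil /det3 /std /= zx1 zy1 zy2 zy3 zy4 zy5; ring.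
have c3 : forall u, u \in ucs L 3 <-> {in ucs_cut 3, forall a, crd e u a = 0}.
  apply: ucs_crd_step c2 _ _ => al.
    move=> H a; rewrite !inE; do ?[case/orP]; move/eqP->.
    - exact: hy2 (H y4 x1 isT) (H y4 y1 isT).
    - exact: hy3 (H y4 x1 isT).
    - exact: hy4 (H y5 y2 isT).
    - exact: hy5 (H y4 y2 isT).
  move=> be z a.
  have [zy2 zy3 zy4 zy5] := And4 (z y2 isT) (z y3 isT) (z y4 isT) (z y5 isT).
  rewrite !inE; do ?[case/orP]; move/eqP->;
  rewrite /P /tri !big_cons big_nil /det3 /std /= zy2 zy3 zy4 zy5; ring.
have c4 : forall u, u \in ucs L 4 <-> {in ucs_cut 4, forall a, crd e u a = 0}.
  apply: ucs_crd_step c3 _ _ => al.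
    move=> H a; rewrite !inE; do ?[case/orP]; move/eqP->.
    - exact: hy4 (H y5 y2 isT).
    - exact: hy5 (H y4 y2 isT).
  move=> be z a.
  have [zy4 zy5] := (z y4 isT, z y5 isT).
  rewrite !inE; do ?[case/orP]; move/eqP->;
  rewrite /P /tri !big_cons big_nil /det3 /std /= zy4 zy5; ring.
by case: k => [|[|[|[|[|//]]]]] _.
Qed.

End CentralSeries.

(** * Invariants of the presentation *)

Section Necessity.

Variable F : fieldType.

Lemma presented_iso (A B : saa F) (f : {linear A -> B})
    (e : label -> A) (e0 : label -> B) (Q : presentation F) :
  (forall u v, f (smul A u v) = smul B (f u) (f v)) ->
  (forall u v, sform B (f u) (f v) = sform A u v) ->
  standard_basis e0 -> presented e Q -> presented (f \o e) Q.
Proof.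
move=> fM fS [e0B _ _ _] [[eB exx eyy exy] inQ outQ].
split=> [|a b c t|a b c]; rewrite /= -?fM ?fS; [|exact: inQ|exact: outQ].
split=> [|i j|i j|i j]; rewrite /= ?fS //.
rewrite basisEfree subvf /= standard_free /=; last first.
  by apply: crd_stdE => i j /=; rewrite fS.
by rewrite size_codom (size_basis (X := codom_tuple e0) e0B).
Qed.

(** The upper central series and the orthogonal of the center force the
    matrix of the change of basis to be block triangular, with blocks
    (p', q'; p, q) on W, c and a on the diagonal and b below it on N.
    Evaluating the trilinear form at the new basis gives the relations: the
    values at y1 make y1 y3 and y1 y2 a basis dual to (y4, y5), in which x1 y3
    has coordinates r' and s'. *)
Lemma change_of_parameters (L : saa F) (e e' : label -> L) (g r s g' r' s' : F) :
  g != 0 -> g' != 0 ->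
  presented e (P10_3_9 g r s) -> presented e' (P10_3_9 g' r' s') ->
  exists a b c p q,
    [/\ c != 0, g' * c ^+ 3 = g, c = a * (q ^+ 2 + r * p * q - s * p ^+ 2),
        r' * c = a * r + b *+ 2
      & s' * c ^+ 2 = - (b ^+ 2 + r * a * b - s * a ^+ 2)].
Proof.
move=> g0 g'0 PP PP'; have [eP _ _] := PP; have [eP' _ _] := PP'.
pose M a b := crd e (e' a) b.
have M_ucs k a : (k <= 4)%N -> {in ucs_cut k, forall b, std a b = 0 :> F} ->
    {in ucs_cut k, forall b, M a b = 0}.
  move=> k4 ak; apply/(ucs_crd g0 PP _ k4)/(ucs_crd g'0 PP' _ k4) => b bk.
  by rewrite crd_std // ak.
have M0 k a : (k <= 4)%N -> all (fun b => a != b) (ucs_cut k) ->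
    {in ucs_cut k, forall b, M a b = 0}.
  move=> k4 /allP ak; apply: M_ucs => // b /ak; rewrite /std.
  by move=> /negPf->.
have Mx2 := M0 2%N x2 isT isT.
have Mx1 := M0 3%N x1 isT isT.
have My1 := M0 3%N y1 isT isT.
have My3 := M0 4%N y3 isT isT.
(* y2 is orthogonal to the center, spanned by x3, x4, x5 in both bases. *)
have My2 : {in [:: y3; y4; y5], forall k, M y2 k = 0}.
  case=> // k ky; rewrite /M /= (standard_basis_omega _ _ eP').
  have xk : {in ucs_cut 1, forall b, crd e' (e (inl k)) b = 0}.
    apply/(ucs_crd g'0 PP')/(ucs_crd g0 PP) => // b bk; rewrite crd_std //.
    by move: ky bk; rewrite !inE => /or3P[]/eqP[->]; do ?[case/orP]; move/eqP->.
  rewrite (omega_ext (frefl _) (crd_std _ eP')) /omega.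
  rewrite (xk x1 isT) (xk x2 isT) (xk y1 isT)
    (xk y2 isT) (xk y3 isT) (xk y4 isT) (xk y5 isT) /std /=.
  ring.
have om a b : omega (M a) (M b) = omega (std a) (std b) :> F.
  rewrite -(standard_basis_omega _ _ eP) (standard_basis_omega _ _ eP').
  by apply: omega_ext; apply: crd_std.
have tr a b c : tri (P10_3_9 g r s) (M a) (M b) (M c) =
    tri (P10_3_9 g' r' s') (std a) (std b) (std c).
  rewrite -(presented_tri _ _ _ (irredundant_P10_3_9 _ _ _) PP)
    (presented_tri _ _ _ (irredundant_P10_3_9 _ _ _) PP').
  by apply: tri_ext; apply: crd_std.
clearbody M; clear M_ucs M0.
pose d := M x2 x2; pose c := M y2 y2; pose a := M y3 y3; pose b := M y3 y2.
pose p' := M x1 x1; pose q' := M x1 y1; pose p := M y1 x1; pose q := M y1 y1.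
have zy2 := And3 (My2 y3 isT) (My2 y4 isT) (My2 y5 isT).
have zx1 := And4 (Mx1 y2 isT) (Mx1 y3 isT) (Mx1 y4 isT) (Mx1 y5 isT).
have zy1 := And4 (My1 y2 isT) (My1 y3 isT) (My1 y4 isT) (My1 y5 isT).
have zy3 := conj (My3 y4 isT) (My3 y5 isT).
have zx2 := 
  And5 (Mx2 y2 isT) (Mx2 y3 isT) (Mx2 y4 isT) (Mx2 y5 isT)
    (conj (Mx2 x1 isT) (Mx2 y1 isT)).
case: zy2 => y23 y24 y25; case: zx1 => x12 x13 x14 x15; case: zy1 => y12 y13 y14 y15.
case: zy3 => y34 y35; case: zx2 => x22 x23 x24 x25 [x21 x21'].
have H1 : p' * q - q' * p = 1.
  transitivity (omega (M x1) (M y1)); last by rewrite om /omega /std /=; ring.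
  by rewrite /p' /q' /p /q /omega x12 x13 x14 x15 y12 y13 y14 y15; ring.
have H2 : c * d = 1.
  transitivity (omega (M x2) (M y2)); last by rewrite om /omega /std /=; ring.
  by rewrite /c /d /omega x21 x21' x22 x23 x24 x25 y23 y24 y25; ring.
pose v44 := M y4 y4; pose v45 := M y4 y5; pose v54 := M y5 y4; pose v55 := M y5 y5.
pose Q := P10_3_9 g r s.
have H3 : g * d * (v44 * v55 - v45 * v54) = g'.
  transitivity (tri Q (M x2) (M y4) (M y5)); last first.
    by rewrite tr /tri !big_cons big_nil /det3 /std /=; ring.
  by rewrite /d /v44 /v45 /v54 /v55
    /tri !big_cons big_nil /det3 /= x21 x21' x22 x23 x24 x25; ring.
have TW w n v : M w y2 = 0 -> M w y3 = 0 -> M w y4 = 0 -> M w y5 = 0 ->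
    M n y4 = 0 -> M n y5 = 0 ->
  tri Q (M w) (M n) (M v) =
    (M n y2 * M w x1 + M n y3 * (r * M w x1 + M w y1)) * M v y4
    + (M n y2 * M w y1 + M n y3 * s * M w x1) * M v y5.
  by move=> w2 w3 w4 w5 n4 n5;
    rewrite /tri !big_cons big_nil /det3 /= w2 w3 w4 w5 n4 n5; ring.
have TE w n v t : tri (P10_3_9 g' r' s') (std w) (std n) (std v) = t ->
   M w y2 = 0 -> M w y3 = 0 -> M w y4 = 0 -> M w y5 = 0 ->
    M n y4 = 0 -> M n y5 = 0 ->
    (M n y2 * M w x1 + M n y3 * (r * M w x1 + M w y1)) * M v y4
    + (M n y2 * M w y1 + M n y3 * s * M w x1) * M v y5 = t.
  by move=> <- *; rewrite -TW // tr.
have K1 : c * p' * v44 + c * q' * v45 = 1.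
  rewrite -(TE x1 y2 y4 1) ?y23 //;
    first by rewrite /c /p' /q' /v44 /v45 /v54 /v55; ring.
  by rewrite /tri !big_cons big_nil /det3 /std /=; ring.
have K2 : c * p' * v54 + c * q' * v55 = 0.
  rewrite -(TE x1 y2 y5 0) ?y23 //;
    first by rewrite /c /p' /q' /v44 /v45 /v54 /v55; ring.
  by rewrite /tri !big_cons big_nil /det3 /std /=; ring.
have K3 : c * p * v44 + c * q * v45 = 0.
  rewrite -(TE y1 y2 y4 0) ?y23 //; first by rewrite /c /p /q /v44 /v45 /v54 /v55; ring.
  by rewrite /tri !big_cons big_nil /det3 /std /=; ring.
have K4 : c * p * v54 + c * q * v55 = 1.
  rewrite -(TE y1 y2 y5 1) ?y23 //; first by rewrite /c /p /q /v44 /v45 /v54 /v55; ring.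
  by rewrite /tri !big_cons big_nil /det3 /std /=; ring.
have L3 : (b * p + a * (r * p + q)) * v44 + (b * q + a * s * p) * v45 = 1.
  rewrite -(TE y1 y3 y4 1) //.
  by rewrite /tri !big_cons big_nil /det3 /std /=; ring.
have L4 : (b * p + a * (r * p + q)) * v54 + (b * q + a * s * p) * v55 = 0.
  rewrite -(TE y1 y3 y5 0) //.
  by rewrite /tri !big_cons big_nil /det3 /std /=; ring.
have L1 : (b * p' + a * (r * p' + q')) * v44 + (b * q' + a * s * p') * v45 = r'.
  rewrite -(TE x1 y3 y4 r') //.
  by rewrite /tri !big_cons big_nil /det3 /std /=; ring.
have L2 : (b * p' + a * (r * p' + q')) * v54 + (b * q' + a * s * p') * v55 = s'.
  rewrite -(TE x1 y3 y5 s') //.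
  by rewrite /tri !big_cons big_nil /det3 /std /=; ring.
have c0 : c != 0.
  by apply: contra_eq_neq H2 => ->; rewrite mul0r eq_sym oner_eq0.
set De := v44 * v55 - v45 * v54 in H3.
have DE : c ^+ 2 * De = 1.
  transitivity (c ^+ 2 * De * (p' * q - q' * p)); first by rewrite H1 mulr1.
  transitivity ((c * p' * v44 + c * q' * v45) * (c * p * v54 + c * q * v55) -
    (c * p' * v54 + c * q' * v55) * (c * p * v44 + c * q * v45)).
    by rewrite /De; ring.
  by rewrite K1 K2 K3 K4; ring.
have De0 : De != 0.
  by apply: contra_eq_neq DE => ->; rewrite mulr0 eq_sym oner_eq0.
(* Solving for a linear form on V with prescribed values at the new y4, y5. *)
have cramer X Y m n : X * v44 + Y * v45 = m -> X * v54 + Y * v55 = n ->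
    X * De = m * v55 - n * v45 /\ Y * De = n * v44 - m * v54.
  by move=> <- <-; split; rewrite /De; ring.
have [A1 A2] := cramer _ _ _ _ K1 K2.
have [B1 B2] := cramer _ _ _ _ K3 K4.
have coords_in X Y m n : X * v44 + Y * v45 = m -> X * v54 + Y * v55 = n ->
    X = m * (c * p') + n * (c * p) /\ Y = m * (c * q') + n * (c * q).
  move=> XYm XYn; have [XE YE] := cramer _ _ _ _ XYm XYn.
  split; apply: (mulIf De0).
    by rewrite XE mulrDl -(mulrA m) -(mulrA n) A1 B1; ring.
  by rewrite YE mulrDl -(mulrA m) -(mulrA n) A2 B2; ring.
(* y1 y3 = x4 and x1 y3 = r' x4 + s' x5 in the new basis. *)
have [EP EQ] := coords_in _ _ _ _ L3 L4.
have [EK EH] := coords_in _ _ _ _ L1 L2.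
rewrite !mul1r !mul0r !addr0 in EP EQ.
pose n := q ^+ 2 + r * p * q - s * p ^+ 2.
have cE : c = a * n.
  transitivity (c * p' * q - c * q' * p); last by rewrite -EP -EQ /n; ring.
  by rewrite -[LHS]mulr1 -H1; ring.
have nq : c * (r * p' * q + q * q' - s * p * p') = b * n + a * r * n.
  transitivity (r * (c * p') * q + q * (c * q') - s * p * (c * p')); first by ring.
  by rewrite -EP -EQ /n; ring.
have r'E : r' * c = b + a * (r * p' * q + q * q' - s * p * p').
  transitivity (r' * c * (p' * q - q' * p)); first by rewrite H1 mulr1.
  transitivity ((b * p' + a * (r * p' + q')) * q - (b * q' + a * s * p') * p).
    by rewrite EK EH; ring.
  by rewrite -[b in RHS]mulr1 -[in RHS]H1; ring.
have anE : a * (r * p' * q + q * q' - s * p * p') = b + a * r.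
  apply: (mulfI c0); rewrite mulrCA nq.
  by transitivity (a * n * (b + a * r)); [ring | rewrite -cE].
exists a, b, c, p, q; split=> //.
- rewrite -H3 -[RHS]mulr1 -DE.
  transitivity (g * (c * d) * (c ^+ 2 * De)); first by ring.
  by rewrite H2; ring.
- by rewrite r'E anE; ring.
transitivity (s' * c ^+ 2 * (p' * q - q' * p)); first by rewrite H1 mulr1.
transitivity ((b * q' + a * s * p') * (c * p') -
  (b * p' + a * (r * p' + q')) * (c * q')).
  by rewrite EK EH; ring.
rewrite -EP -EQ.
transitivity (- (b ^+ 2 + r * a * b - s * a ^+ 2) * (p' * q - q' * p)); first by ring.
by rewrite H1 mulr1.
Qed.

Lemma same_algebra_invariants (g r s g' r' s' : F) :
  2%N \in [pchar F] -> admissible g r s -> admissible g' r' s' ->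
  same_algebra (P10_3_9 g' r' s') (P10_3_9 g r s) ->
  [/\ nonzero_cube (g' / g), in_G r s (r' / r) & in_H r' (s' - (r' / r) ^+ 2 * s)].
Proof.
move=> char2 [g0 r0 _] [g'0 r'0 _] [A [B [[e0 e0P] [e eP] [f [_ fM fS]]]]].
have feP : presented (f \o e0) (P10_3_9 g' r' s').
  by case: eP => eB _ _; exact: presented_iso fM fS eB e0P.
have [a [b [c [p [q [c0 gE cE rE sE]]]]]] := change_of_parameters g0 g'0 eP feP.
have b2 : b *+ 2 = 0 by rewrite mulr2n addrr_pchar2.
rewrite b2 addr0 in rE.
have nE : a * (q ^+ 2 + r * p * q + s * p ^+ 2) = c.
  by rewrite cE (oppr_pchar2 char2 (s * p ^+ 2)).
have a0 : a != 0 by apply: contraNneq c0 => a0; rewrite cE a0 mul0r.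
have rr : r' / r = a / c.
  by apply: (mulIf c0); rewrite divfK // mulrAC rE mulfK.
split.
- exists c^-1; rewrite ?invr_eq0 //.
  by rewrite -gE exprVn; field; rewrite c0 g'0.
(* a / c = (a / c)^2 (c / a), and c / a is the value of the norm form at (q, p). *)
- exists (q * (a / c)), (p * (a / c)).
  have E : r' / r = (q * (a / c)) ^+ 2 + r * (q * (a / c)) * (p * (a / c))
                    + s * (p * (a / c)) ^+ 2.
    rewrite rr; transitivity (a / c * (a * (q ^+ 2 + r * p * q + s * p ^+ 2) / c)).
      by rewrite nE divff // mulr1.
    by field.
  split=> //; apply: contraNneq r'0 => -[q0 p0].
  have: r' / r = 0 by rewrite E q0 p0; ring.
  by move=> /eqP; rewrite mulf_eq0 invr_eq0 (negPf r0) orbF.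
exists (b / c); rewrite rr.
have -> : s' = (b ^+ 2 + r * a * b + s * a ^+ 2) / c ^+ 2.
  apply: (mulIf (expf_neq0 2 c0)); rewrite sE divfK ?expf_neq0 //.
  by rewrite !(oppr_pchar2 char2).
have -> : r' = a * r / c by rewrite -rE mulfK.
by field.
Qed.

End Necessity.

(** * Irreducible minimal polynomials in dimension two *)

Lemma irreducible_no_root (F : fieldType) (p : {poly F}) la :
  irreducible_poly p -> size p != 2%N -> ~~ root p la.
Proof.
move=> p_irr; apply: contra; rewrite -dvdp_XsubCl => dvd_p.
by rewrite -(eqp_size (p_irr.2 _ _ dvd_p)) size_XsubC.
Qed.

Lemma size_quadratic (F : fieldType) (r s : F) : size ('X^2 + r *: 'X + s%:P) = 3%N.
Proof.
rewrite -addrA size_polyDl size_polyXn //.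
apply: leq_ltn_trans (size_polyD _ _) _; rewrite gtn_max.
rewrite (leq_ltn_trans (size_scale_leq _ _)) ?size_polyX //.
by rewrite (leq_ltn_trans (size_polyC_leq1 _)).
Qed.

Section PlaneEndomorphism.

Variables (F : fieldType) (V : vectType F) (f : 'End(V)) (m : {poly F}).
Hypotheses (mf : is_minpoly f m) (m_irr : irreducible_poly m).
Hypothesis f_not_scalar : forall la, ~ (forall v, f v = la *: v).

Lemma lfun_evalE (p : {poly F}) v :
  lfun_eval p f v = \sum_(i < size p) p`_i *: iter i f v.
Proof.
rewrite /lfun_eval sum_lfunE; apply: eq_bigr => i _; rewrite scale_lfunE.
by congr (_ *: _); elim: (nat_of_ord i) => [|n IH]; rewrite ?id_lfunE //= comp_lfunE IH.
Qed.

(** A root of a linear minimal polynomial would make f a scalar. *)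
Lemma minpoly_size_neq2 : size m != 2%N.
Proof.
have [m_monic mf0 _] := mf; apply/eqP => m2.
apply: (f_not_scalar (la := - m`_0)) => v.
have m1 : m`_1 = 1 by have := monicP m_monic; rewrite lead_coefE m2.
have := lfun_evalE m v; rewrite mf0 zero_lfunE m2 !big_ord_recl big_ord0 /= m1.
by rewrite scale1r addr0 => /esym/eqP; rewrite addrC addr_eq0 scaleNr => /eqP.
Qed.

(** An eigenvalue would be a root of the minimal polynomial, which is
    irreducible of degree at least 2. *)
Lemma minpoly_no_eigenvector la z : f z = la *: z -> z = 0.
Proof.
move=> fz; have [_ mf0 _] := mf; apply/eqP.
have : m.[la] *: z = 0.
  rewrite -[0](zero_lfunE V z) -mf0 lfun_evalE horner_coef scaler_suml.
  apply: eq_bigr => i _; rewrite -scalerA; congr (_ *: _).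
  elim: (nat_of_ord i) => [|n IH]; rewrite ?scale1r //= -IH linearZ /= fz.
  by rewrite scalerA -exprSr.
by move=> /eqP; rewrite scaler_eq0 -rootE
  (negPf (irreducible_no_root _ m_irr minpoly_size_neq2)).
Qed.

(** The quadratic polynomial kills f, as f is a companion matrix in the basis
    (z, f z), and the minimal polynomial has degree at least 2. *)
Lemma minpoly_quadratic r s z :
  f (f z) = r *: f z + s *: z -> (forall v, exists i j, v = i *: z + j *: f z) ->
  m = 'X^2 - r *: 'X - s%:P.
Proof.
move=> ffz zspan; have [m_monic _ mdvd] := mf.
set p := 'X^2 - _ - _.
have p3 : size p = 3%N by rewrite /p -scaleNr -polyCN size_quadratic.
have p_coef i : p`_i = (i == 2)%:R - r * (i == 1)%:R - s * (i == 0)%:R.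
  rewrite /p !coefB coefXn coefZ coefX coefC; congr (_ - _).
  by case: ifP; rewrite ?mulr1 ?mulr0.
have p_monic : p \is monic.
  by rewrite monicE lead_coefE p3 p_coef /= !mulr0 !subr0.
have pf0 : lfun_eval p f = 0.
  apply/lfunP => v; rewrite zero_lfunE lfun_evalE p3 !big_ord_recl big_ord0 /=.
  rewrite !p_coef /= !mulr0 !mulr1 !subr0 !sub0r addr0 scale1r !scaleNr.
  (* The relation holds at z, hence at f z, hence on their span. *)
  have -> : f (f v) = r *: f v + s *: v; last by rewrite addKr addNr.
  have [i [j ->]] := zspan v.
  have fffz : f (f (f z)) = r *: f (f z) + s *: f z.
    by rewrite {1}ffz linearD !linearZ.
  rewrite !linearD !linearZ /= fffz {1}ffz !scalerDr addrACA.
  by rewrite !scalerA.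
have m_p := mdvd _ pf0.
have m3 : size m = 3%N.
  apply/eqP; rewrite eqn_leq; apply/andP; split.
    by rewrite -p3 dvdp_leq // monic_neq0.
  by rewrite ltn_neqAle eq_sym minpoly_size_neq2 m_irr.1.
apply/eqP; rewrite -(eqp_monic m_monic p_monic).
by rewrite -dvdp_size_eqp // m3 p3.
Qed.

End PlaneEndomorphism.

Lemma irreducible_quadratic_scale (F : fieldType) (a r s : F) :
  2%N \in [pchar F] -> a != 0 ->
  irreducible_poly ('X^2 - (r / a) *: 'X - (s / a ^+ 2)%:P) ->
  irreducible_poly ('X^2 + r *: 'X + s%:P).
Proof.
move=> char2 a0 p_irr.
apply: cubic_irreducible => [|x]; first by rewrite size_quadratic.
apply/rootP; rewrite !hornerE => x0.
have := irreducible_no_root (x / a) p_irr.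
rewrite -scaleNr -polyCN size_quadratic => /(_ isT)/rootP; apply.
rewrite !(hornerD, hornerZ, hornerXn, hornerX, hornerC) !(oppr_pchar2 char2).
transitivity ((x ^+ 2 + r * x + s) / a ^+ 2); first by field.
by rewrite x0 mul0r.
Qed.

(** * The triple products of an adapted basis *)

Section Orthogonality.

Variables (F : fieldType) (L : saa F).

Definition perp (U : {vspace L}) (w : L) := {in U, forall u, sform L u w = 0}.

Lemma perpD (U V : {vspace L}) w : perp U w -> perp V w -> perp (U + V)%VS w.
Proof.
by move=> Uw Vw _ /memv_addP[u uU [v vV ->]]; rewrite linearDl Uw ?Vw ?addr0.
Qed.

Lemma perp_line u w : sform L u w = 0 -> perp <[u]>%VS w.
Proof. by move=> uw _ /vlineP[k ->]; rewrite linearZl_LR /= uw mulr0. Qed.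

Lemma perp_smulv (U V : {vspace L}) (w : L) :
  {in U & V, forall u v, triple u v w = 0} -> perp (smulv U V) w.
Proof.
move=> UVw z; rewrite /smulv; set s := (X in <<X>>%VS) => zs.
rewrite (coord_span (X := in_tuple s) zs) linear_sumlz big1 // => i _.
rewrite linearZl_LR /=; have : s`_i \in s by rewrite mem_nth.
rewrite {2}/s => /allpairsP[[u v] /= [uU vV ->]].
by rewrite -/(triple u v w) UVw ?mulr0 // vbasis_mem.
Qed.

Lemma ucs_triple k u v w : u \in ucs L k.+1 -> perp (ucs L k) w -> triple u v w = 0.
Proof. by move=> /memv_ucsS uk; apply. Qed.

End Orthogonality.

Section AdaptedBasis.

Variables (F : fieldType) (L : saa F) (e : label -> L).
Hypothesis eA : adapted_basis e.

Let eB : standard_basis e. Proof. by case: eA. Qed.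

Lemma sform_std a b : sform L (e a) (e b) = crd e (e a) (dual_label b) *
  (match b with inl _ => -1 | inr _ => 1 end).
Proof. by case: b => i /=; rewrite ?mulr1 // mulrN1 -sform_skew. Qed.

Lemma sform0 a b : dual_label b != a -> sform L (e a) (e b) = 0.
Proof.
by move=> ab; rewrite sform_std crd_std // /std eq_sym (negPf ab) mul0r.
Qed.

(** The basis vectors orthogonal to the span of some of the x_i, possibly with
    y1, are those that are not dual to one of its generators. *)
Lemma perp_ucs : 
  [/\ forall a, a \notin [:: y3; y4; y5] -> perp (ucs L 1) (e a),
      forall a, a \notin [:: y2; y3; y4; y5] -> perp (ucs L 2) (e a),
      forall a, a \in [:: x2; x3; x4; x5] -> perp (ucs L 3) (e a)
    & forall a, a \notin [:: y4; y5] -> perp (lpow L 5) (e a)].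
Proof.
have [_ [E5 [E1 [E4 [E2 [E3 [E3' [E2' E4']]]]]]]] := eA.
have p5 a : a \notin [:: y4; y5] -> perp (lpow L 5) (e a).
  rewrite E5 !inE !negb_or => /andP[a4 a5].
  by apply: perpD; apply: perp_line; apply: sform0; case: a a4 a5.
have p1 a : a \notin [:: y3; y4; y5] -> perp (ucs L 1) (e a).
  rewrite -/(center L) E1 !inE !negb_or => /and3P[a3 a4 a5].
  apply: perpD; first by apply: p5; rewrite !inE !negb_or a4.
  by apply: perp_line; apply: sform0; case: a a3 a4 a5.
have p2 a : a \notin [:: y2; y3; y4; y5] -> perp (ucs L 2) (e a).
  rewrite E2 !inE !negb_or => /and4P[a2 a3 a4 a5].
  apply: perpD; first by apply: p1; rewrite !inE !negb_or a3 a4.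
  by apply: perp_line; apply: sform0; case: a a2 a3 a4 a5.
split=> // a ax.
have pa : perp (ucs L 2) (e a).
  by apply: p2; move: ax; rewrite !inE => /or4P[]/eqP->.
rewrite E3' E4; apply: perpD; first apply: perpD => //.
  by apply: perp_line; apply: sform0; move: ax; rewrite !inE => /or4P[]/eqP->.
by apply: perp_line; apply: sform0; move: ax; rewrite !inE => /or4P[]/eqP->.
Qed.

Lemma basis_ucs :
  [/\ {in [:: x3; x4; x5], forall a, e a \in ucs L 1}, e x2 \in ucs L 2,
      {in [:: x1; y1], forall a, e a \in ucs L 3 /\ e a \in lpow L 3},
      e y2 \in lpow L 2 & e y3 \in ucs L 4].
Proof.
have [_ [E5 [E1 [E4 [E2 [E3 [E3' [E2' E4']]]]]]]] := eA.
split.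
- move=> a; rewrite -/(center L) E1 E5 !inE => /or3P[]/eqP->.
  + by rewrite (subvP (addvSr _ _)) ?memv_line.
  + by rewrite (subvP (addvSl _ _)) // (subvP (addvSr _ _)) ?memv_line.
  + by rewrite (subvP (addvSl _ _)) // (subvP (addvSl _ _)) ?memv_line.
- by rewrite E2 (subvP (addvSr _ _)) ?memv_line.
- move=> a; rewrite E3 E3' !inE => /orP[]/eqP->.
    by rewrite (subvP (addvSl _ _)) // (subvP (addvSr _ _)) ?memv_line.
  by rewrite (subvP (addvSr _ _)) ?memv_line.
- by rewrite E2' (subvP (addvSr _ _)) ?memv_line.
- by rewrite E4' (subvP (addvSr _ _)) ?memv_line.
Qed.

Hypothesis L32 : smulv (lpow L 3) (lpow L 2) = lpow L 5.

(** Apart from a = b, each disjunct is a reason for (a b, c) to vanish: a b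
    lies in a term of the central series, or in L^5 = L^3 L^2 for the last one,
    to which c is orthogonal. *)
Definition vanishing (a b c : label) : bool :=
  [|| a == b, a \in [:: x3; x4; x5], (a == x2) && (c \notin [:: y3; y4; y5]),
      (a == y3) && (c \in [:: x2; x3; x4; x5]),
      (a \in [:: x1; y1]) && (c \notin [:: y2; y3; y4; y5])
    | [&& a \in [:: x1; y1], b == y2 & c \notin [:: y4; y5]]].

Lemma vanishingP a b c : vanishing a b c -> triple (e a) (e b) (e c) = 0.
Proof.
have [p1 p2 p3 p5] := perp_ucs; have [b1 b2 b3 b2' b4] := basis_ucs.
case/or4P => [/eqP->|ax|/andP[/eqP-> cn]|/or3P[/andP[/eqP-> cx]|/andP[aw cn]|]].
- by rewrite /triple smul_alt linear0l.
- apply: ucs_triple (b1 _ ax) _ => u; rewrite memv0 => /eqP->; exact: linear0l.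
- exact: ucs_triple b2 (p1 _ cn).
- exact: ucs_triple b4 (p3 _ cx).
- exact: ucs_triple (b3 _ aw).1 (p2 _ cn).
case/and3P=> aw /eqP-> cn; apply: (p5 _ cn).
rewrite -L32; exact: (smulvP _ _ _ (subvv _)) (b3 _ aw).2 b2'.
Qed.

Definition support : seq (seq label) :=
  [:: [:: x2; y4; y5]; [:: x1; y2; y4]; [:: x1; y2; y5]; [:: y1; y2; y4];
      [:: y1; y2; y5]; [:: x1; y3; y4]; [:: x1; y3; y5]; [:: y1; y3; y4];
      [:: y1; y3; y5]; [:: x1; y4; y5]; [:: y1; y4; y5]; [:: y2; y3; y4];
      [:: y2; y3; y5]; [:: y2; y4; y5]; [:: y3; y4; y5]].

Definition labels := [:: x1; x2; x3; x4; x5; y1; y2; y3; y4; y5].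

Lemma mem_labels a : a \in labels.
Proof. by case: a => -[[|[|[|[|[|//]]]]] lti]. Qed.

Lemma vanishing_or_support a b c :
  [|| has (perm_eq [:: a; b; c]) support,
      vanishing a b c, vanishing b c a, vanishing c a b,
      vanishing b a c, vanishing c b a | vanishing a c b].
Proof.
suff /allP/(_ _ (mem_labels a))/allP/(_ _ (mem_labels b))/allP/(_ _ (mem_labels c)) :
  all (fun a => all (fun b => all (fun c =>
   [|| has (perm_eq [:: a; b; c]) support,
      vanishing a b c, vanishing b c a, vanishing c a b,
      vanishing b a c, vanishing c b a | vanishing a c b]) labels) labels) labels by [].
by vm_compute.
Qed.

(** Each triple product outside the support vanishes after a
    reordering of its arguments. *)
Lemma adapted_presented : 
  presented e (filtered (triple (e x2) (e y4) (e y5))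
    (triple (e x1) (e y2) (e y4)) (triple (e x1) (e y2) (e y5))
    (triple (e y1) (e y2) (e y4)) (triple (e y1) (e y2) (e y5))
    (triple (e x1) (e y3) (e y4)) (triple (e x1) (e y3) (e y5))
    (triple (e y1) (e y3) (e y4)) (triple (e y1) (e y3) (e y5))
    (triple (e x1) (e y4) (e y5)) (triple (e y1) (e y4) (e y5))
    (triple (e y2) (e y3) (e y4)) (triple (e y2) (e y3) (e y5))
    (triple (e y2) (e y4) (e y5)) (triple (e y3) (e y4) (e y5))).
Proof.
set P := filtered _ _ _ _ _ _ _ _ _ _ _ _ _ _ _.
have PT : all (fun q => q.2 == triple (e q.1.1.1) (e q.1.1.2) (e q.1.2)) P.
  by rewrite /= !eqxx.
split=> // [a b c t /(allP PT)/eqP /= ->//|a b c out]; rewrite -/(triple _ _ _).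
have nsupp : ~~ has (perm_eq [:: a; b; c]) support.
  rewrite -[support]/(map (fun q => [:: q.1.1.1; q.1.1.2; q.1.2]) P) has_map.
  by apply/hasPn => -[[[i j] k] t]; apply: out.
have := vanishing_or_support a b c; rewrite (negPf nsupp) /=.
have sw u v w : triple v u w = 0 -> triple u v w = 0.
  by rewrite -[triple u v w]opprK -triple_swap => ->; rewrite oppr0.
case/or4P=> [/vanishingP//|/vanishingP abc0|/vanishingP abc0|].
- by rewrite triple_cyclic.
- by rewrite -triple_cyclic.
case/or3P=> /vanishingP abc0.
- exact: sw.
- by rewrite triple_cyclic sw.
- by rewrite -triple_cyclic sw.
Qed.

End AdaptedBasis.

(** * Non-degeneracy of the reduced tensor *)

Section FilteredForm.

Variables (F : fieldType) (L : saa F) (e : label -> L).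
Hypothesis eA : adapted_basis e.
Hypothesis L32 : smulv (lpow L 3) (lpow L 2) = lpow L 5.
Variables g f14 f15 f24 f25 g14 g15 g24 g25 h1 h2 b4 b5 d2 d3 : F.
Hypothesis eP : presented e
  (filtered g f14 f15 f24 f25 g14 g15 g24 g25 h1 h2 b4 b5 d2 d3).

Let P : presentation F :=
  filtered g f14 f15 f24 f25 g14 g15 g24 g25 h1 h2 b4 b5 d2 d3.
Let eB : standard_basis e. Proof. by case: eA. Qed.

Arguments crd : simpl never.

Lemma filtered_triple u v w : triple u v w = tri P (crd e u) (crd e v) (crd e w).
Proof. by rewrite (presented_tri _ _ _ _ eP). Qed.

Lemma filtered_triple_std a v w : triple (e a) v w = tri P (std a) (crd e v) (crd e w).
Proof. by rewrite filtered_triple; apply: tri_ext => // i; rewrite crd_std. Qed.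

Lemma sform_dual i : sform L (e (inl i)) (e (inr i)) = 1.
Proof. by case: eB => _ _ _ ->; rewrite eqxx. Qed.

(** Otherwise x2 would be central, but y2 is orthogonal to the center and not
    to x2. *)
Lemma gamma_neq0 : g != 0.
Proof.
apply/eqP=> g0; have [p1 _ _ _] := perp_ucs eA.
have x2Z : e x2 \in ucs L 1.
  apply/memv_ucsS => v; rewrite memv0; apply/eqP/sform_nondeg => w.
  rewrite -/(triple _ _ _) filtered_triple_std /P g0.
  by rewrite /tri !big_cons big_nil /det3 /std /=; ring.
have := p1 y2 isT _ x2Z; rewrite sform_dual => /eqP.
by rewrite oner_eq0.
Qed.

Lemma crd_perp U a : perp U (e (dual_label a)) -> {in U, forall u, crd e u a = 0}.
Proof.
by move=> Ua u uU; case: a Ua => i /= Ua; rewrite /crd ?Ua // sform_skew Ua // oppr0.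
Qed.

Lemma crd_lpow3 u : u \in lpow L 3 ->
  [/\ crd e u y2 = 0, crd e u y3 = 0, crd e u y4 = 0 & crd e u y5 = 0].
Proof.
have [_ [_ [_ [_ [_ [-> _]]]]]] := eA; have [_ _ p3 _] := perp_ucs eA.
by move=> u3; split; apply: crd_perp u3; apply: p3.
Qed.

Lemma crd_lpow2 u : u \in lpow L 2 ->
  [/\ crd e u y3 = 0, crd e u y4 = 0 & crd e u y5 = 0].
Proof.
have [_ [_ [_ [_ [_ [_ [_ [-> _]]]]]]]] := eA.
case/memv_addP=> u3 /crd_lpow3[_ u33 u34 u35] [_ /vlineP[k ->] ->].
rewrite addrC.
by split; rewrite (crd_linear e k) crd_std // /std mulr0 add0r.
Qed.

Lemma triple_lpow u v w : u \in lpow L 3 -> v \in lpow L 2 ->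
  triple u v w = crd e v y2 *
   ((f14 * crd e u x1 + f24 * crd e u y1) * crd e w y4 +
    (f15 * crd e u x1 + f25 * crd e u y1) * crd e w y5).
Proof.
move=> /crd_lpow3[u2 u3 u4 u5] /crd_lpow2[v3 v4 v5].
rewrite filtered_triple /P /tri !big_cons big_nil /det3 /= u2 u3 u4 u5 v3 v4 v5; ring.
Qed.

(** Modulo L^4, the plane L^3 is spanned by x1 and y1, and L^3 L^2 = L^3 y2.
    If y2 induced a degenerate pairing of W and V, then L^5 would be orthogonal
    to a nonzero combination of y4 and y5, while L^5 is spanned by x4 and
    x5. *)
Lemma phi_det_neq0 : f14 * f25 - f15 * f24 != 0.
Proof.
apply/eqP=> D0.
have [_ [E5 _]] := eA.
have x4L : e x4 \in lpow L 5 by rewrite E5 (subvP (addvSr _ _)) ?memv_line.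
have x5L : e x5 \in lpow L 5 by rewrite E5 (subvP (addvSl _ _)) ?memv_line.
have key k4 k5 : f14 * k4 + f15 * k5 = 0 -> f24 * k4 + f25 * k5 = 0 ->
    k4 = 0 /\ k5 = 0.
  move=> H1 H2; set w := k4 *: e y4 + k5 *: e y5.
  have cw a : crd e w a = k4 * std y4 a + k5 * std y5 a.
    rewrite /w crd_linear -[k5 *: _]addr0 crd_linear !crd_std //.
    by case: a => i; rewrite /crd ?linear0l ?linear0r addr0.
  (* L^5 is L^3 L^2, and it contains x4 and x5, which read off k4 and k5. *)
  have pw : perp (lpow L 5) w.
    rewrite -L32; apply: perp_smulv => u v u3 v2; rewrite triple_lpow // !cw /std /=.
    transitivity (crd e v y2 * (crd e u x1 * (f14 * k4 + f15 * k5)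
                                + crd e u y1 * (f24 * k4 + f25 * k5))); first by ring.
    by rewrite H1 H2; ring.
  have := pw _ x4L; have := pw _ x5L; rewrite /w !linearDr !linearZr_LR /=.
  rewrite !sform_dual [sform L _ (e y4)]sform0 // [sform L (e x4) (e y5)]sform0 //.
  by rewrite !mulr0 !mulr1 addr0 add0r.
have [f15z f14z] : f15 = 0 /\ - f14 = 0.
  by apply: key; [ring | rewrite -[RHS]oppr0 -D0; ring].
have f14z' : f14 = 0 by apply: oppr_inj; rewrite oppr0.
have [f25z f24z] : f25 = 0 /\ - f24 = 0.
  by apply: key; rewrite ?f14z' ?f15z; ring.
have f24z' : f24 = 0 by apply: oppr_inj; rewrite oppr0.
have [] := key 1 1; rewrite ?f14z' ?f15z ?f25z ?f24z' ?mul0r ?addr0 //.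
by move=> /eqP; rewrite oner_eq0.
Qed.

Lemma mem_ucs2 u : (forall a, a \in [:: x1; y1; y2; y3; y4; y5] -> crd e u a = 0) ->
  u \in ucs L 2.
Proof.
have [b1 b2 _ _ _] := basis_ucs eA.
have [_ [_ [_ [_ [E2 _]]]]] := eA.
have Z2 a : a \in [:: x3; x4; x5] -> e a \in ucs L 2.
  by move=> ax; rewrite E2 (subvP (addvSl _ _)) //; apply: b1.
move=> u0; rewrite (standard_basisE u eB) big_label.
rewrite (u0 x1 isT) (u0 y1 isT) (u0 y2 isT) (u0 y3 isT) (u0 y4 isT) (u0 y5 isT).
rewrite !scale0r !addr0 add0r.
by rewrite !rpredD // rpredZ // Z2.
Qed.

(** Otherwise y3 - la y2 would annihilate L^3, hence its products would be
    orthogonal to L^3 and lie in Z_2: it would be in Z_3, which is orthogonal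
    to x3. *)
Lemma psi_not_scalar la :
  ~ [/\ g14 = la * f14, g15 = la * f15, g24 = la * f24 & g25 = la * f25].
Proof.
case=> E14 E15 E24 E25; have [_ _ p3 _] := perp_ucs eA.
set z := (- la) *: e y2 + e y3.
have cz a : crd e z a = - la * std y2 a + std y3 a.
  by rewrite /z crd_linear !crd_std.
suff z3 : z \in ucs L 3.
  have := p3 x3 isT _ z3; rewrite /z linearDl linearZl_LR /=.
  rewrite [sform L (e y2) _]sform0 // mulr0 add0r sform_skew sform_dual => /eqP.
  by rewrite oppr_eq0 oner_eq0.
apply/memv_ucsS => v; apply: mem_ucs2 => a aS.
have : triple z v (e (dual_label a)) = 0.
  rewrite filtered_triple (tri_ext _ cz (frefl _) (crd_std _ eB)).
  move: aS; rewrite !inE; do ?[case/orP]; move/eqP->;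
  rewrite /P /tri !big_cons big_nil /det3 /std /= ?E14 ?E15 ?E24 ?E25; ring.
by case: a {aS} => i; rewrite /crd /triple // => H; rewrite sform_skew H oppr0.
Qed.

Lemma sform_ext (u v : L) : (forall w, sform L u w = sform L v w) -> u = v.
Proof.
move=> uv; apply/eqP; rewrite -subr_eq0; apply/eqP/sform_nondeg => w.
by rewrite linearBl /= uv subrr.
Qed.

Lemma smul_y2 u : u \in lpow L 3 -> smul L u (e y2) =
  (f14 * crd e u x1 + f24 * crd e u y1) *: e x4
  + (f15 * crd e u x1 + f25 * crd e u y1) *: e x5.
Proof.
have [_ _ _ y2L _] := basis_ucs eA.
move=> u3; apply: sform_ext => w; rewrite -/(triple u _ w) triple_lpow // crd_std //.
by rewrite /std eqxx mul1r linearDl /= !linearZl_LR.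
Qed.

Lemma smul_y3 u : u \in lpow L 3 -> smul L u (e y3) =
  (g14 * crd e u x1 + g24 * crd e u y1) *: e x4
  + (g15 * crd e u x1 + g25 * crd e u y1) *: e x5.
Proof.
move=> /crd_lpow3[u2 u3 u4 u5]; apply: sform_ext => w; rewrite -/(triple u _ w).
rewrite linearDl /= !linearZl_LR /= -/(crd e w y4) -/(crd e w y5).
rewrite filtered_triple (tri_ext _ (frefl _) (crd_std _ eB) (frefl _)).
rewrite /P /tri !big_cons big_nil /det3 /std /= u2 u3 u4 u5; ring.
Qed.

Lemma quo_actionE y u :
  quo_action y u = vsproj (lpow L 5) (smul L (vsval u) y).
Proof.
exact: (lfunE (vsproj (lpow L 5) \o applyr (smul L) y \o vsval) u).
Qed.

Let X4 := vsproj (lpow L 5) (e x4).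
Let X5 := vsproj (lpow L 5) (e x5).

Lemma x45_lpow5 : e x4 \in lpow L 5 /\ e x5 \in lpow L 5.
Proof.
have [_ [E5 _]] := eA.
by rewrite E5 (subvP (addvSr _ _)) ?(subvP (addvSl _ _)) ?memv_line.
Qed.

Lemma X45_free i j : i *: X4 + j *: X5 = 0 -> i = 0 /\ j = 0.
Proof.
have [x4L x5L] := x45_lpow5.
move=> /(congr1 vsval); rewrite linear0 linearD !linearZ /= !vsprojK // => ij0.
have cij a : crd e (i *: e x4 + j *: e x5) a = i * std x4 a + j * std x5 a.
  rewrite crd_linear -[j *: _]addr0 crd_linear !crd_std //.
  by case: a => k; rewrite /crd ?linear0l ?linear0r addr0.
split; [have := cij x4 | have := cij x5]; rewrite ij0 /std /crd /= linear0l => ->; ring.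
Qed.

Lemma X45_span (v : subvs_of (lpow L 5)) : exists i j, v = i *: X4 + j *: X5.
Proof.
have [_ [E5 _]] := eA; have [x4L x5L] := x45_lpow5.
have: vsval v \in (<[e x5]> + <[e x4]>)%VS by rewrite -E5 subvsP.
case/memv_addP=> [_ /vlineP[j ->] [_ /vlineP[i ->] vE]].
by exists i, j; apply: val_inj; rewrite /= vE !vsprojK // addrC.
Qed.

(** The products of L^3 by y2 and y3 depend only on classes modulo L^4, and y2
    acts injectively on a complement of L^4 by phi_det_neq0, so that the
    inverse used in tau is a true inverse there. *)
Lemma tau_smul u : u \in lpow L 3 ->
  tau (e y2) (e y3) (vsproj (lpow L 5) (smul L u (e y2))) =
  vsproj (lpow L 5) (smul L u (e y3)).
Proof.
have [_ [_ [_ [E4 _]]]] := eA.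
have crd4 u4 : u4 \in lpow L 4 -> crd e u4 x1 = 0 /\ crd e u4 y1 = 0.
  have [_ p2 _ _] := perp_ucs eA.
  by rewrite E4 => u42; split; apply: crd_perp u42; apply: p2.
have lpow4I w : w \in ucs L 2 -> w \in lpow L 4 by rewrite E4.
have L43 : (lpow L 4 <= lpow L 3)%VS.
  have [_ [_ [_ [_ [_ [E3 [E3' _]]]]]]] := eA.
  by rewrite E3 E3' -addvA addvSl.
have smul4 u4 : u4 \in lpow L 4 -> smul L u4 (e y2) = 0 /\ smul L u4 (e y3) = 0.
  move=> u44; have [c1 c2] := crd4 _ u44; have u43 := subvP L43 _ u44.
  by rewrite smul_y2 // smul_y3 // c1 c2 !mulr0 !addr0 !scale0r addr0.
have mem_diff u' : u' \in (lpow L 3 :\: lpow L 4)%VS -> u' \in lpow L 3.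
  by apply/subvP; exact: diffvSl.
have inj : lker (quo_action (L := L) (e y2)) == 0%VS.
  apply/lker0P => u1 u2 /eqP; rewrite -subr_eq0 -linearB /= => /eqP.
  set u0 := u1 - u2; rewrite quo_actionE => u00.
  suff u00' : vsval u0 = 0 by apply/eqP; rewrite -subr_eq0; apply/eqP/val_inj.
  have u3 := mem_diff _ (subvsP u0).
  move: u00; rewrite smul_y2 // linearD !linearZ /= => /X45_free[z4 z5].
  have D0 := phi_det_neq0.
  have cx : crd e (vsval u0) x1 = 0.
    apply: (mulfI D0); rewrite mulr0.
    transitivity (f25 * (f14 * crd e (vsval u0) x1 + f24 * crd e (vsval u0) y1) -
                  f24 * (f15 * crd e (vsval u0) x1 + f25 * crd e (vsval u0) y1)).
      by ring.
    by rewrite z4 z5; ring.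
  have cy : crd e (vsval u0) y1 = 0.
    apply: (mulfI D0); rewrite mulr0.
    transitivity (f14 * (f15 * crd e (vsval u0) x1 + f25 * crd e (vsval u0) y1) -
                  f15 * (f14 * crd e (vsval u0) x1 + f24 * crd e (vsval u0) y1)).
      by ring.
    by rewrite z4 z5; ring.
  have u04 : vsval u0 \in lpow L 4.
    have [c2 c3 c4 c5] := crd_lpow3 u3.
    apply: lpow4I; apply: mem_ucs2 => a; rewrite !inE; do ?[case/orP]; by move/eqP->.
  apply/eqP; rewrite -memv0 -(capv_diff (lpow L 3) (lpow L 4)) memv_cap u04 andbT.
  exact: (subvsP u0).
move=> u3; have : u \in (lpow L 3 :\: lpow L 4 + lpow L 4)%VS.
  by rewrite addv_diff (subvP (addvSl _ _)).
case/memv_addP=> v v3 [w w4 ->]; have [w2 w3] := smul4 _ w4.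
rewrite !linearDl /= w2 w3 !addr0.
pose v' := vsproj (lpow L 3 :\: lpow L 4) v.
have vE : v = vsval v' by rewrite vsprojK.
by rewrite vE -!quo_actionE /tau comp_lfunE lker0_lfunK.
Qed.

Lemma tau_x1 : tau (e y2) (e y3) (f14 *: X4 + f15 *: X5) = g14 *: X4 + g15 *: X5.
Proof.
have [_ _ w3 _ _] := basis_ucs eA; have x13 := (w3 x1 isT).2.
have := tau_smul x13; rewrite smul_y2 // smul_y3 // !crd_std // /std /=.
by rewrite !mulr1 !mulr0 !addr0 !linearD !linearZ.
Qed.

Lemma tau_y1 : tau (e y2) (e y3) (f24 *: X4 + f25 *: X5) = g24 *: X4 + g25 *: X5.
Proof.
have [_ _ w3 _ _] := basis_ucs eA; have y13 := (w3 y1 isT).2.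
have := tau_smul y13; rewrite smul_y2 // smul_y3 // !crd_std // /std /=.
by rewrite !mulr1 !mulr0 !add0r !linearD !linearZ.
Qed.

Lemma X45_inj i j i' j' : i *: X4 + j *: X5 = i' *: X4 + j' *: X5 -> i = i' /\ j = j'.
Proof.
move=> /eqP; rewrite -subr_eq0 opprD addrACA -!scalerBl => /eqP/X45_free[/eqP + /eqP].
by rewrite !subr_eq0 => /eqP-> /eqP->.
Qed.

Lemma tau_not_scalar la : ~ (forall v, tau (e y2) (e y3) v = la *: v).
Proof.
move=> tla; apply: (@psi_not_scalar la).
have := tla (f14 *: X4 + f15 *: X5).
rewrite tau_x1 scalerDr !scalerA => /X45_inj[-> ->].
have := tla (f24 *: X4 + f25 *: X5).
rewrite tau_y1 scalerDr !scalerA => /X45_inj[-> ->].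
by [].
Qed.

Variable m : {poly F}.
Hypothesis m_min : is_minpoly (tau (e y2) (e y3)) m.
Hypothesis m_irr : irreducible_poly m.

(** If y1 y2 and y1 y3 were dependent, then y1 y2 would be an eigenvector of
    tau. *)
Lemma psi_det_neq0 : g24 * f25 - g25 * f24 != 0.
Proof.
apply/eqP => D0; have phiD := phi_det_neq0.
have no_la la : g24 = la * f24 -> g25 = la * f25 -> False.
  move=> E24 E25.
  have /X45_free[z4 z5] : f24 *: X4 + f25 *: X5 = 0.
    apply: (minpoly_no_eigenvector m_min m_irr tau_not_scalar (la := la)).
    by rewrite tau_y1 scalerDr !scalerA E24 E25.
  by move: phiD; rewrite z4 z5 !mulr0 subrr eqxx.
have [f24z | f24n] := eqVneq f24 0.
  have f25n : f25 != 0 by apply: contra_neq phiD => ->; rewrite f24z; ring.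
  apply: (no_la (g25 / f25)); last by rewrite divfK.
  by apply: (mulIf f25n); rewrite f24z mulr0 mul0r; move: D0; rewrite f24z mulr0 subr0.
apply: (no_la (g24 / f24)); first by rewrite divfK.
apply: (mulIf f24n); rewrite mulrAC divfK //.
by apply/esym/eqP; rewrite -subr_eq0 D0.
Qed.

Hypothesis char2 : 2%N \in [pchar F].
Hypothesis m1_neq0 : m`_1 != 0.

Let dF := f14 * f25 - f15 * f24.
Let dG := g24 * f25 - g25 * f24.
Let q' := (f14 * g25 - f15 * g24) / dG.
Let a := dF / dG.
Let r := (g14 * f25 - g15 * f24) / dG + q'.
Let s := - (a * (g14 * g25 - g15 * g24) / dG).

(** With x1' = x1 + q' y1 and a chosen so that x1' y2 = a y1 y3, the map tau
    sends y1 y2 to y1 y3 and y1 y3 to a combination whose coefficients r / a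
    and s / a^2 are, up to sign, those of the minimal polynomial of tau. *)
Lemma typeC_admissible : admissible (g / dF) r s.
Proof.
have dF0 := phi_det_neq0; have dG0 := psi_det_neq0.
have a0 : a != 0 by rewrite mulf_neq0 ?invr_eq0.
pose z := f24 *: X4 + f25 *: X5.
have z'E : tau (e y2) (e y3) z = g24 *: X4 + g25 *: X5 by exact: tau_y1.
have z'a : tau (e y2) (e y3) z = a^-1 *: (f14 *: X4 + f15 *: X5) + (q' / a) *: z.
  rewrite z'E /z !scalerDr !scalerA addrACA -!scalerDl.
  by congr (_ *: _ + _ *: _); rewrite /a /q' /dF /dG; field; rewrite dF0 dG0.
have cyc : tau (e y2) (e y3) (tau (e y2) (e y3) z) =
    (r / a) *: tau (e y2) (e y3) z + (s / a ^+ 2) *: z.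
  rewrite {1}z'a linearD !linearZ /= tau_x1 z'E /z !scalerDr !scalerA.
  rewrite addrACA -!scalerDl [RHS]addrACA -!scalerDl.
  by congr (_ *: _ + _ *: _); rewrite /r /s /a /q' /dF /dG; field; rewrite dF0 dG0.
(* Cramer's rule in the basis (y1 y2, y1 y3) of L^5. *)
have span v : exists i j, v = i *: z + j *: tau (e y2) (e y3) z.
  have [i [j ->]] := X45_span v.
  exists ((g24 * j - g25 * i) / dG), ((i * f25 - j * f24) / dG).
  rewrite z'E /z !scalerDr !scalerA addrACA -!scalerDl.
  by congr (_ *: _ + _ *: _); rewrite /dG; field.
have mE := minpoly_quadratic m_min m_irr tau_not_scalar cyc span.
split.
- by rewrite mulf_neq0 ?invr_eq0 ?gamma_neq0.
- apply: contra_neq m1_neq0 => r0; rewrite mE r0 mul0r scale0r subr0.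
  by rewrite coefB coefXn coefC subr0.
apply: (irreducible_quadratic_scale char2 a0); by rewrite -mE.
Qed.

End FilteredForm.

(** * Normal form *)

Section NormalForm.

Variables (F : fieldType) (L : saa F).

(** The determinant f14 f25 - f15 f24 allows to solve for the coefficients p,
    q that remove (y2 y3, y4) and (y2 y3, y5); adding multiples of x2 removes
    the other terms, as gamma is not zero. *)
Lemma filtered_reduced (e : label -> L)
    (g f14 f15 f24 f25 g14 g15 g24 g25 h1 h2 b4 b5 d2 d3 : F) :
  g != 0 -> f14 * f25 - f15 * f24 != 0 ->
  presented e (filtered g f14 f15 f24 f25 g14 g15 g24 g25 h1 h2 b4 b5 d2 d3) ->
  exists e', presented (L := L) e' (reduced g f14 f15 f24 f25 g14 g15 g24 g25).
Proof.
move=> g0 dF0 eP; pose dF := f14 * f25 - f15 * f24.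
pose k1 := - h1 / g; pose k2 := - h2 / g.
(* The values at (y2 y3, y4) and (y2 y3, y5) after the change by k1 and k2. *)
pose c4 := b4 + k2 * g14 - k1 * g24; pose c5 := b5 + k2 * g15 - k1 * g25.
pose p := (c4 * f25 - c5 * f24) / dF; pose q := (c5 * f14 - c4 * f15) / dF.
pose C := - (d2 + k2 * h1 - k1 * h2) / g; pose D := - (d3 + p * h1 + q * h2) / g.
exists (new_basis e (unipotent k1 k2 p q C D)).
apply: change_of_basis eP _ _ => // al be; first exact: unipotent_omega.
move=> ka; rewrite unipotent_tri -tri_filtered.
congr (tri (filtered _ _ _ _ _ _ _ _ _ _ _ _ _ _ _) al be ka).
- by rewrite /k1; field.
- by rewrite /k2; field.
- by rewrite /p /q /c4 /c5 /dF; field.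
- by rewrite /p /q /c4 /c5 /dF; field.
- by rewrite /C divfK // subrr.
- by rewrite /D divfK // subrr.
Qed.

(** Take y1 and y2 unchanged, a y3 as the new y3, (y1 y2, a y1 y3) as the new
    (x5, x4) and x1 + q' y1 as the new x1, for the q' and a that solve
    (x1 + q' y1) y2 = a y1 y3. *)
Lemma reduced_normal_form (e : label -> L)
    (g f14 f15 f24 f25 g14 g15 g24 g25 : F) :
  let dF := f14 * f25 - f15 * f24 in
  let dG := g24 * f25 - g25 * f24 in
  let q' := (f14 * g25 - f15 * g24) / dG in
  dF != 0 -> dG != 0 ->
  presented e (reduced g f14 f15 f24 f25 g14 g15 g24 g25) ->
  has_presentation L (P10_3_9 (g / dF)
    ((g14 * f25 - g15 * f24) / dG + q')
    (- (dF / dG * (g14 * g25 - g15 * g24) / dG))).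
Proof.
move=> dF dG q' dF0 dG0 eP; pose a := dF / dG.
exists (new_basis e (levi 1 q' 0 1 a 0 1 (a * g24) (a * g25) f24 f25)).
have a0 : a != 0 by rewrite mulf_neq0 ?invr_eq0.
have DE : a * g24 * f25 - a * g25 * f24 = dF.
  by transitivity (a * dG); [rewrite /dG mulrBr !mulrA | rewrite /a divfK].
have D0 : a * g24 * f25 - a * g25 * f24 != 0 by rewrite DE.
apply: change_of_basis eP _ _ => // al be.
  by apply: levi_omega; rewrite ?oner_eq0 //; ring.
move=> ka; rewrite tri_P10_3_9 levi_tri ?oner_eq0 //= DE.
congr (tri (reduced _ _ _ _ _ _ _ _ _) al be ka).
- by rewrite mul1r.
all: by move: dF0 dG0; rewrite /a /q' /dF /dG => dF0 dG0; field; rewrite ?dF0 ?dG0.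
Qed.

End NormalForm.

Theorem proposition7p21 (F : fieldType) (charF2 : 2%N \in [pchar F]) :
  (forall L : saa F,
     saa_nilpotent L ->
     \dim {:L} = 10%N ->
     isotropic (center L) ->
     \dim (center L) = 3%N ->
     \dim (lpow L 3) = 6%N ->
     smulv (lpow L 3) (lpow L 2) = lpow L 5 ->
     type_C_nonzero_linear_term L ->
     exists gamma r s : F,
       admissible gamma r s /\ has_presentation L (P10_3_9 gamma r s))
  /\
  (forall gamma r s gamma' r' s' : F,
     admissible gamma r s ->
     admissible gamma' r' s' ->
     (same_algebra (P10_3_9 gamma' r' s') (P10_3_9 gamma r s) <->
      [/\ nonzero_cube (gamma' / gamma),
          in_G r s (r' / r)
        & in_H r' (s' - (r' / r) ^+ 2 * s)])).
Proof.
split=> [L _ _ _ _ _ L32 [e [m [eA m_min m_irr m1]]] | g r s g' r' s' adm adm'].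
  have eP := adapted_presented eA L32.
  have dG0 := psi_det_neq0 eA L32 eP m_min m_irr.
  have dF0 := phi_det_neq0 eA L32 eP.
  have adm := typeC_admissible eA L32 eP m_min m_irr charF2 m1.
  have [e' e'P] := filtered_reduced (gamma_neq0 eA eP) dF0 eP.
  have hasP := reduced_normal_form dF0 dG0 e'P.
  by do 3!eexists; split; [exact: adm | exact: hasP].
split=> [|[gE rE sE]]; first exact: same_algebra_invariants.
exact: P10_3_9_same.
Qed.
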